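(* For every function $c=c(k)$, $$\lim_{k\to\infty}\sigma\big((k,c)\text{-Sparse-}\oplus\text{Set Cover}/n\big)\le\lim_{k'\to\infty}\sigma\big(k'\text{-}\oplus\text{Set Cover}/(n+t)\big).$$
   Context: $(k,c)$-Sparse-$\oplus$Set Cover: given $\mathcal F\subseteq 2^U$ with $|U|=n$, $|\mathcal F|\le c(k)\,n$, every set of size at most $k$, decide whether the number of $\mathcal C\subseteq\mathcal F$ with $\bigcup_{S\in\mathcal C}S=U$ is odd. $k'$-$\oplus$Set Cover: given an integer $t$ and $\mathcal F\subseteq 2^U$ with $|U|=n$, every set of size at most $k'$, decide whether the number of $\mathcal C\subseteq\mathcal F$ with $|\mathcal C|=t$ and $\bigcup_{S\in\mathcal C}S=U$ is odd. For a problem $\Pi$ with input size $m$ and a numerical parameter $p$ of the instance, $\sigma(\Pi/p)$ is the infimum of all $\epsilon>0$ such that $\Pi$ has a randomized algorithm with error probability at most $1/3$ running in time $2^{\epsilon p}\mathrm{poly}(m)$. *)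

(* Defs.v *)
From HB Require Import structures.
From mathcomp Require Import all_boot all_order all_algebra.
From mathcomp Require Import all_classical all_reals all_analysis.

Set Implicit Arguments.
Unset Strict Implicit.
Unset Printing Implicit Defensive.

Import Order.TTheory GRing.Theory Num.Theory.
Local Open Scope ring_scope.

(** * Randomized algorithms

    The machine model is the WHILE language over binary trees (N. D. Jones,
    "Computability and Complexity from a Programming Perspective"), extended
    with a fair coin.  Trees are immutable and shared, so every primitive is
    charged unit cost.  A RAM with logarithmic cost simulates such a program,
    with trees held as pointers, and is simulated by one, with the memory held
    as a binary trie, both with overhead polylogarithmic in the running time.
    The exponents considered below are therefore those of the RAM model. *)

Inductive tree := Leaf | Node of tree & tree.

Fixpoint tsize (x : tree) : nat :=
  if x is Node y z then (tsize y + tsize z).+1 else 1%N.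

Definition is_node (x : tree) : bool := if x is Node _ _ then true else false.

Inductive expr :=
| EVar of nat
| ELeaf
| ENode of expr & expr
| ELeft of expr
| ERight of expr.

Inductive cmd :=
| Assign of nat & expr
| Flip of nat
| Seq of cmd & cmd
| If of expr & cmd & cmd
| While of expr & cmd.

Definition store := nat -> tree.

Definition upd (s : store) (i : nat) (x : tree) : store :=
  fun j => if j == i then x else s j.

Fixpoint eval (s : store) (e : expr) : tree :=
  match e with
  | EVar i => s i
  | ELeaf => Leaf
  | ENode e1 e2 => Node (eval s e1) (eval s e2)
  | ELeft e1 => if eval s e1 is Node y _ then y else Leaf
  | ERight e1 => if eval s e1 is Node _ z then z else Leaf
  end.

Fixpoint ecost (e : expr) : nat :=
  match e with
  | EVar _ | ELeaf => 1%N
  | ENode e1 e2 => (ecost e1 + ecost e2).+1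
  | ELeft e1 | ERight e1 => (ecost e1).+1
  end.

Definition bit (b : bool) : tree := if b then Node Leaf Leaf else Leaf.

(** [exec p s v s' t]: started in [s], the program [p] stops in [s'] after [t]
    steps if its coin flips come out as the successive entries of [v]; all of
    [v] is consumed. *)
Inductive exec : cmd -> store -> seq bool -> store -> nat -> Prop :=
| ExecAssign s i e : exec (Assign i e) s [::] (upd s i (eval s e)) (ecost e)
| ExecFlip s i b : exec (Flip i) s [:: b] (upd s i (bit b)) 1
| ExecSeq p q s s1 s2 v w t u :
    exec p s v s1 t -> exec q s1 w s2 u ->
    exec (Seq p q) s (v ++ w) s2 (t + u)
| ExecIf e p q s s1 v t :
    exec (if is_node (eval s e) then p else q) s v s1 t ->
    exec (If e p q) s v s1 (ecost e + t)
| ExecStop e p s :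
    ~~ is_node (eval s e) -> exec (While e p) s [::] s (ecost e)
| ExecLoop e p s s1 s2 v w t u :
    is_node (eval s e) ->
    exec p s v s1 t -> exec (While e p) s1 w s2 u ->
    exec (While e p) s (v ++ w) s2 (ecost e + t + u).

(** Variable 0 holds the input on start and the answer on halting; every other
    variable starts as [Leaf].  The answer is "yes" when it is not [Leaf]. *)
Definition init (x : tree) : store := upd (fun=> Leaf) 0 x.

Definition run (p : cmd) (x : tree) (v : seq bool) (b : bool) (t : nat) : Prop :=
  exists2 s, exec p (init x) v s t & is_node (s 0%N) = b.

(** A coin flip takes one step, so [T] coins suffice for [T] steps. *)
Definition halts_within (p : cmd) (x : tree) (T : nat) : Prop :=
  forall w : T.-tuple bool,
    exists v b t, [/\ prefix v w, run p x v b t & (t <= T)%N].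

Definition errs (p : cmd) (x : tree) (b : bool) (w : seq bool) : Prop :=
  exists v t, prefix v w /\ run p x v (~~ b) t.

Definition error_prob (R : realType) (p : cmd) (x : tree) (b : bool) (T : nat)
  : R :=
  #|[pred w : T.-tuple bool | `[< errs p x b w >]]|%:R / 2 ^+ T.

(** * Parameterized decision problems *)

(** An instance may have several encodings (listings of a set in different
    orders); an algorithm has to succeed on all of them. *)
Record problem := Problem {
  instance : Type;
  param : instance -> nat;
  answer : instance -> bool;
  encodes : instance -> tree -> Prop
}.

Definition solvable_in (R : realType) (P : problem) (e : R) : Prop :=
  exists (p : cmd) (C d : nat),
    forall (I : instance P) (x : tree), encodes I x ->
      exists T : nat,
        [/\ T%:R <= 2 `^ (e * (param I)%:R) * (C%:R * (tsize x)%:R ^+ d),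
            halts_within p x T &
            error_prob R p x (answer I) T <= 1 / 3].

Definition sigma (R : realType) (P : problem) : \bar R :=
  ereal_inf (fun z : \bar R =>
    exists e : R, [/\ 0 < e, solvable_in P e & z = e%:E]).

(** * Parity set cover *)

Fixpoint list_tree (l : seq tree) : tree :=
  if l is x :: l' then Node x (list_tree l') else Leaf.

(** Binary digits, least significant first. *)
Fixpoint pos_digits (p : BinNums.positive) : seq bool :=
  match p with
  | BinNums.xH => [:: true]
  | BinNums.xO q => false :: pos_digits q
  | BinNums.xI q => true :: pos_digits q
  end.

Definition nat_digits (n : nat) : seq bool :=
  if bin_of_nat n is BinNums.Npos p then pos_digits p else [::].

Definition nat_tree (n : nat) : tree := list_tree (map bit (nat_digits n)).

Definition set_tree (n : nat) (S : {set 'I_n}) : tree :=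
  list_tree [seq bit (i \in S) | i <- enum 'I_n].

(** The universe ['I_n] is listed as [n] leaves and the family as the rows of
    its incidence matrix, in any order. *)
Definition encodes_family (n : nat) (F : {set {set 'I_n}}) (x : tree) : Prop :=
  exists2 L : seq {set 'I_n}, perm_eq L (enum F)
    & x = Node (list_tree (nseq n Leaf)) (list_tree (map (@set_tree n) L)).

Definition set_covers (n : nat) (F : {set {set 'I_n}}) : {set {set {set 'I_n}}} :=
  [set C : {set {set 'I_n}} | (C \subset F) && (finset.cover C == [set: 'I_n])]%SET.

Record sparse_instance (R : realType) (k : nat) (c : nat -> R) := SparseInstance {
  sp_n : nat;
  sp_family : {set {set 'I_sp_n}};
  sp_size : forall S, S \in sp_family -> (#|S| <= k)%N;
  sp_sparse : #|sp_family|%:R <= c k * sp_n%:R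
}.

Definition sparse_parity_set_cover (R : realType) (k : nat) (c : nat -> R)
  : problem := {|
  instance := sparse_instance k c;
  param I := sp_n I;
  answer I := odd #|set_covers (sp_family I)|;
  encodes I x := encodes_family (sp_family I) x
|}.

Record sc_instance (k : nat) := ScInstance {
  sc_n : nat;
  sc_t : nat;
  sc_family : {set {set 'I_sc_n}};
  sc_size : forall S, S \in sc_family -> (#|S| <= k)%N
}.

(** The parameter is [n + t]. *)
Definition parity_set_cover (k : nat) : problem := {|
  instance := sc_instance k;
  param I := (sc_n I + sc_t I)%N;
  answer I := odd #|[set C in set_covers (sc_family I) | #|C| == sc_t I]%SET|;
  encodes I x :=
    exists2 y, encodes_family (sc_family I) y & x = Node (nat_tree (sc_t I)) y
|}.

(* Main.v *)
Require Import Defs.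
From mathcomp Require Import all_boot all_order all_algebra.
From mathcomp Require Import all_classical all_reals all_analysis.
From mathcomp Require Import zify lra.
Import Defs.

Set Implicit Arguments.
Unset Strict Implicit.
Unset Printing Implicit Defensive.

(** Cut the family into [m <= |F| / q + 1] chunks of at most [q] sets.  A
    subfamily of [F] is the choice of one subset [X] of every chunk, so replace
    chunk [j] by the [2 ^ q] unions of its subsets, each extended by a new element
    [tag j].  A cover by exactly [m] sets must then take one union from every
    chunk.  Distinct subsets may have equal unions; to keep them apart, [q] further
    elements, shared by all chunks, record which sets of the chunk were united, and
    one additional set, forced by an element [mark] of its own, covers all of
    these.  The covers of [F] thus correspond to the covers by exactly [m + 1] sets
    of a family of sets of size at most [q (k + 1) + 1] over [n + m + q + 1]
    elements.  As [|F| <= c n], the new parameter is [n (1 + 2 c / q) + O(q)], and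
    [q] can be taken arbitrarily large. *)

(** * Programs *)

(** Since [q] is fixed before [n], the [2 ^ q] unions per chunk keep the reduction polynomial, and
    the additive O(q) in the parameter costs only a constant factor in the running time. The 2 in
    [2 c / q] arises because [m] enters the parameter twice, as the number of tags and inside [t].
    The set size [q (k + 1) + 1] grows with [q], so no single k' serves all precisions: this is
    where the limit over k' is used. Parity demands a bijection of covers, not just equisolvability,
    which is why equal unions must be kept apart. As [solvable_in] speaks of concrete programs, the
    reduction has to be exhibited as one. A calculus of polynomial-time functions, closed under
    composition, pairing, branching and loops, produces it. That program reads no coins, so it does
    not increase the error probability. *)

Lemma exec_det p s v s1 t : exec p s v s1 t ->
  forall w s2 u a b, exec p s w s2 u -> v ++ a = w ++ b ->
  [/\ v = w, s1 = s2 & t = u].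
Proof.
elim=> {p s v s1 t}.
- by move=> s i e w s2 u a b H _; inversion H; subst.
- by move=> s i c w s2 u a b H; inversion H; subst=> -[->].
- move=> p q s s1 s2 v w t u _ IHp _ IHq v' s' u' a b H.
  inversion H as [| |? ? ? s3 ? v1 w1 t1 u1 Hp Hq| | |]; subst.
  rewrite -!catA => E.
  have [E1 E2 E3] := IHp _ _ _ _ _ Hp E; subst.
  have {}E : w ++ a = w1 ++ b by move/eqP: E; rewrite eqseq_cat // eqxx => /eqP.
  by have [-> -> ->] := IHq _ _ _ _ _ Hq E.
- move=> e p q s s1 v t _ IH w s2 u a b H E.
  inversion H as [| | |? ? ? ? ? ? ? Hp| |]; subst.
  by have [-> -> ->] := IH _ _ _ _ _ Hp E.
- move=> e p s nn w s2 u a b H E.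
  inversion H as [| | | |? ? ? nn'|? ? ? ? ? ? ? ? ? nn']; subst => //.
  by rewrite nn' in nn.
- move=> e p s s1 s2 v w t u nn _ IHp _ IHq v' s' u' a b H.
  inversion H as [| | | |? ? ? nn'|? ? ? s3 ? v1 w1 t1 u1 nn' Hp Hq]; subst.
    by rewrite nn in nn'.
  rewrite -!catA => E.
  have [E1 E2 E3] := IHp _ _ _ _ _ Hp E; subst.
  have {}E : w ++ a = w1 ++ b by move/eqP: E; rewrite eqseq_cat // eqxx => /eqP.
  by have [-> -> ->] := IHq _ _ _ _ _ Hq E.
Qed.

Fixpoint written_below (p : cmd) : nat :=
  match p with
  | Assign i _ | Flip i => i.+1
  | Seq p q | If _ p q => maxn (written_below p) (written_below q)
  | While _ p => written_below p
  end.

Lemma exec_frame p s v s' t i :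
  exec p s v s' t -> (written_below p <= i)%N -> s' i = s i.
Proof.
elim=> {p s v s' t} /=.
- by move=> s j e le; rewrite /upd gtn_eqF.
- by move=> s j c le; rewrite /upd gtn_eqF.
- move=> p q s s1 s2 v w t u _ IHp _ IHq; rewrite geq_max => /andP[lp lq].
  by rewrite IHq // IHp.
- by move=> e p q s s1 v t _ IH; rewrite geq_max => /andP[lp lq]; apply: IH; case: ifP.
- by [].
- by move=> e p s s1 s2 v w t u _ _ IHp _ IHq le; rewrite IHq // IHp.
Qed.

(** The language has no skip; assigning variable 0 to itself stands in for it. *)
Fixpoint clear (n : nat) : cmd :=
  if n is m.+1 then Seq (Assign n ELeaf) (clear m) else Assign 0 (EVar 0).

Lemma exec_clear n s : exec (clear n) s [::]
  (fun i => if (0 < i <= n)%N then Leaf else s i) n.+1.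
Proof.
elim: n s => [|n IH] s /=.
  have -> : (fun i => if (0 < i <= 0)%N then Leaf else s i) = upd s 0 (eval s (EVar 0)).
    by apply/funext=> i /=; rewrite /upd; case: i.
  exact: ExecAssign.
set s' := fun _ => _.
have -> : s' = (fun i => if (0 < i <= n)%N then Leaf else upd s n.+1 Leaf i).
  apply/funext=> i; rewrite /s' /upd; case: eqP => [->|ne]; first by rewrite leqnn if_same.
  by congr (if _ then _ else _); lia.
by apply: (@ExecSeq _ _ _ _ _ [::] [::] 1 n.+1) (IH _); apply: ExecAssign.
Qed.

Lemma exec_seq0 p q s s1 s2 t u :
  exec p s [::] s1 t -> exec q s1 [::] s2 u -> exec (Seq p q) s [::] s2 (t + u).
Proof. exact: (@ExecSeq p q s s1 s2 [::] [::]). Qed.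

(** * Preprocessing the input by a coin-free program *)

Section Prefix.
Variables (p0 p : cmd) (x y : tree) (t0 : nat).
Hypothesis exec0 : exec p0 (init x) [::] (init y) t0.

Lemma run_seq v b t : run p y v b t -> run (Seq p0 p) x v b (t0 + t).
Proof. by case=> s H <-; exists s => //; apply: (@ExecSeq _ _ _ _ _ [::]) exec0 H. Qed.

Lemma run_seq_inv v b t : run (Seq p0 p) x v b t ->
  exists2 t', run p y v b t' & t = (t0 + t')%N.
Proof.
case=> s H eb; inversion H as [| |? ? ? s3 ? v1 w1 t1 u1 Hp Hq| | |]; subst.
have [E1 E2 E3] := exec_det exec0 Hp (a := v1) (b := [::]) (esym (cats0 _)).
by subst; exists u1 => //; exists s.
Qed.

(** [halts_within] ties the number of available coins to the time bound, so the [t0] extra steps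
    bring [t0] extra coins. These come last and stay unread. *)
Lemma halts_within_seq T : halts_within p y T -> halts_within (Seq p0 p) x (t0 + T).
Proof.
move=> H w.
have sT : size (take T w) == T by rewrite size_take_min size_tuple; apply/eqP; lia.
have [v [b [t [pv rv le]]]] := H (Tuple sT).
exists v, b, (t0 + t)%N; split; last by rewrite leq_add2l.
  by apply: prefix_trans pv (prefix_take _ _).
exact: run_seq.
Qed.

End Prefix.

Lemma run_det p x v b t v' b' t' w : run p x v b t -> run p x v' b' t' ->
  prefix v w -> prefix v' w -> [/\ v = v', b = b' & t = t'].
Proof.
case=> s H <- [s' H' <-] /prefixP[a ->] /prefixP[a' E].
by have [-> -> ->] := exec_det H H' E.
Qed.

(** A tuple in [Q] is fixed by its first [T] coins, which lie in [P], and [T0] free ones. After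
    division by [2 ^ (T0 + T)], surplus coins thus do not raise a probability. *)
Lemma card_take_tuple T T0 (P : pred (T.-tuple bool)) (Q : pred ((T0 + T).-tuple bool)) :
  (forall w : (T0 + T).-tuple bool, Q w ->
     exists2 u : T.-tuple bool, P u & take T w = u) ->
  (#|Q| <= #|P| * 2 ^ T0)%N.
Proof.
move=> H.
pose f (z : T.-tuple bool * T0.-tuple bool) : (T0 + T).-tuple bool :=
  tcast (addnC T T0) (cat_tuple z.1 z.2).
have sub : Q \subset [set f z | z in [predX P & predT]].
  apply/fintype.subsetP=> w Qw; have [u Pu tw] := H _ Qw.
  have sd : size (drop T w) == T0 by rewrite size_drop size_tuple addnK.
  apply/imsetP; exists (u, Tuple sd); first by rewrite !inE /= andbT.
  by apply: val_inj; rewrite /= val_tcast /= -tw cat_take_drop.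
apply: leq_trans (subset_leq_card sub) _.
apply: leq_trans (leq_imset_card _ _) _.
rewrite cardX leq_mul2l; apply/orP; right.
by rewrite [X in (X <= _)%N]cardT -cardE card_tuple card_bool.
Qed.

(** * Functions computable in polynomial time *)

(** The encodings are chosen to reproduce the trees of the problem instances: a universe is a
    [seq unit], a row of the incidence matrix or a binary number a [seq bool]. *)
Class Enc (A : Type) := enc : A -> tree.

#[global] Instance enc_unit : Enc unit := fun=> Leaf.
#[global] Instance enc_bool : Enc bool := bit.
#[global] Instance enc_prod A B {EA : Enc A} {EB : Enc B} : Enc (A * B) :=
  fun x => Node (enc x.1) (enc x.2).
#[global] Instance enc_seq A {EA : Enc A} : Enc (seq A) :=
  fun l => list_tree (map enc l).

Definition esize A {EA : Enc A} (a : A) : nat := tsize (enc a).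

Lemma tsize_gt0 x : (0 < tsize x)%N.
Proof. by case: x. Qed.

Lemma esize_gt0 A {EA : Enc A} (a : A) : (0 < esize a)%N.
Proof. exact: tsize_gt0. Qed.

Lemma esize_pair A B {EA : Enc A} {EB : Enc B} (a : A) (b : B) :
  esize (a, b) = (esize a + esize b).+1.
Proof. by []. Qed.

Lemma esize_cons A {EA : Enc A} (a : A) l : esize (a :: l) = (esize a + esize l).+1.
Proof. by []. Qed.

Lemma esize_nil A {EA : Enc A} : esize ([::] : seq A) = 1%N.
Proof. by []. Qed.

Lemma size_esize A {EA : Enc A} (l : seq A) : (size l < esize l)%N.
Proof. by elim: l => // a l IH; rewrite esize_cons ltnS (leq_trans IH) // leq_addl. Qed.

(** The base is at least 2, so constants and coefficients can be absorbed into the exponent and a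
    single number describes the bound. *)
Definition polybounded A {EA : Enc A} (g : A -> nat) : Prop :=
  exists e, forall a, (g a <= (esize a).+1 ^ e)%N.

Section PolyBounded.
Context {A : Type} {EA : Enc A}.
Implicit Types g h : A -> nat.

Lemma leq_pb (a : A) d e : (d <= e)%N -> ((esize a).+1 ^ d <= (esize a).+1 ^ e)%N.
Proof. by move=> le; rewrite leq_pexp2l. Qed.

Lemma pb_le g h : (forall a, (g a <= h a)%N) -> polybounded h -> polybounded g.
Proof. by move=> le [e H]; exists e => a; apply: leq_trans (le a) (H a). Qed.

Lemma pb_const c : polybounded (fun _ : A => c).
Proof.
exists c => a; apply: leq_trans (ltnW (ltn_expl c (ltnSn 1))) _.
by case: c => // c; rewrite leq_exp2r // ltnS esize_gt0.
Qed.

Lemma pb_size : polybounded (fun a : A => esize a).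
Proof. by exists 1%N => a; rewrite expn1. Qed.

Lemma pbM g h : polybounded g -> polybounded h -> polybounded (fun a => g a * h a)%N.
Proof. by move=> [d H] [e K]; exists (d + e)%N => a; rewrite expnD leq_mul. Qed.

Lemma pbD g h : polybounded g -> polybounded h -> polybounded (fun a => g a + h a)%N.
Proof.
move=> [d H] [e K]; exists (maxn d e).+1 => a.
have := leq_pb a (leq_maxl d e); have := leq_pb a (leq_maxr d e).
have := H a; have := K a; rewrite expnS => ? ? ? ?.
apply: (@leq_trans (2 * (esize a).+1 ^ maxn d e)); first by lia.
by rewrite leq_mul // ltnS esize_gt0.
Qed.

Lemma pbS g : polybounded g -> polybounded (fun a => (g a).+1).
Proof. by move=> H; apply: pb_le (pbD H (pb_const 1)) => a; lia. Qed.

Lemma pbX g e : polybounded g -> polybounded (fun a => g a ^ e)%N.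
Proof.
move=> H; elim: e => [|e IH]; first exact: pb_const.
by apply: pb_le (pbM H IH) => a; rewrite expnS.
Qed.

Lemma pb_comp B {EB : Enc B} (f : A -> B) (g : B -> nat) :
  polybounded (fun a => esize (f a)) -> polybounded g -> polybounded (fun a => g (f a)).
Proof.
move=> H [e K]; apply: pb_le (pbX e (pbS H)) => a; exact: K.
Qed.

End PolyBounded.

Ltac polyb := repeat match goal with
  | |- polybounded (fun _ => addn _ _) => apply: pbD
  | |- polybounded (fun _ => muln _ _) => apply: pbM
  | |- polybounded (fun _ => expn _ _) => apply: pbX
  | |- polybounded (@esize _ _) => exact: pb_size
  | H : polybounded _ |- polybounded _ => exact: H
  | |- polybounded _ => exact: pb_const
  end.

(** The program is asked to work at every address [N] and to leave the
    variables below [N] alone, so that it can be called from another program. *)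
Definition computes A B {EA : Enc A} {EB : Enc B} (f : A -> B) (tm : A -> nat)
    (N : nat) (p : cmd) : Prop :=
  forall s a, s N = enc a -> exists s' t,
    [/\ exec p s [::] s' t, s' N = enc (f a), forall i, (i < N)%N -> s' i = s i
      & (t <= tm a)%N].

(** The output size needs a bound of its own: with shared trees a cheap assignment can double a
    tree, so a time bound does not limit sizes. *)
Definition polytime A B {EA : Enc A} {EB : Enc B} (f : A -> B) : Prop :=
  polybounded (fun a => esize (f a)) /\
  exists2 tm, polybounded tm & forall N, exists p, computes f tm N p.

(** * Closure under composition, pairing and branching *)

Section Combinators.
Context {A : Type} {EA : Enc A}.

Lemma pt_ext B {EB : Enc B} (f g : A -> B) : f =1 g -> polytime f -> polytime g.
Proof. by move=> /funext ->. Qed.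

Lemma pt_expr B {EB : Enc B} (f : A -> B) (e : nat -> expr) (c : nat) :
  (forall N s a, s N = enc a -> eval s (e N) = enc (f a)) ->
  (forall N, ecost (e N) = c) ->
  polybounded (fun a => esize (f a)) -> polytime f.
Proof.
move=> He Hc Hs; split=> //; exists (fun=> c); first exact: pb_const.
move=> N; exists (Assign N (e N)) => s a Na.
exists (upd s N (eval s (e N))), (ecost (e N)); split.
- exact: ExecAssign.
- by rewrite /upd eqxx (He _ _ a).
- by move=> i ltN; rewrite /upd ltn_eqF.
- by rewrite Hc.
Qed.

End Combinators.

Section Basic.
Context {A : Type} {EA : Enc A}.

Lemma pt_id : polytime (fun a : A => a).
Proof. by apply: (@pt_expr _ _ _ _ _ EVar 1) => //; apply: pb_size. Qed.

Lemma pt_comp B C {EB : Enc B} {EC : Enc C} (g : B -> C) (f : A -> B) :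
  polytime g -> polytime f -> polytime (fun a => g (f a)).
Proof.
move=> [sg [tg Tg Pg]] [sf [tf Tf Pf]]; split; first exact: pb_comp sf sg.
exists (fun a => tf a + tg (f a))%N; first exact: pbD Tf (pb_comp sf Tg).
move=> N; have [p Hp] := Pf N; have [q Hq] := Pg N.
exists (Seq p q) => s a Na.
have [s1 [t1 [E1 N1 F1 L1]]] := Hp _ _ Na.
have [s2 [t2 [E2 N2 F2 L2]]] := Hq _ _ N1.
exists s2, (t1 + t2)%N; split => //; first exact: exec_seq0 E1 E2.
  by move=> i ltN; rewrite F2 // F1.
exact: leq_add.
Qed.

Lemma pt_fst B C {EB : Enc B} {EC : Enc C} (f : A -> B * C) :
  polytime f -> polytime (fun a => (f a).1).
Proof.
apply: pt_comp; apply: (@pt_expr _ _ _ _ fst (fun N => ELeft (EVar N)) 2) => //.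
  by move=> N s a /= ->.
by apply: pb_le pb_size => -[b c]; rewrite esize_pair /=; lia.
Qed.

Lemma pt_snd B C {EB : Enc B} {EC : Enc C} (f : A -> B * C) :
  polytime f -> polytime (fun a => (f a).2).
Proof.
apply: pt_comp; apply: (@pt_expr _ _ _ _ snd (fun N => ERight (EVar N)) 2) => //.
  by move=> N s a /= ->.
by apply: pb_le pb_size => -[b c]; rewrite esize_pair /=; lia.
Qed.

Fixpoint quote (x : tree) : expr :=
  if x is Node y z then ENode (quote y) (quote z) else ELeaf.

Lemma pt_const B {EB : Enc B} (b : B) : polytime (fun _ : A => b).
Proof.
apply: (@pt_expr _ _ _ _ _ (fun=> quote (enc b)) (ecost (quote (enc b)))) => //.
  by move=> N s _ _; elim: (enc b) => //= y -> z ->.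
exact: pb_const.
Qed.

Lemma pt_pair B C {EB : Enc B} {EC : Enc C} (f : A -> B) (g : A -> C) :
  polytime f -> polytime g -> polytime (fun a => (f a, g a)).
Proof.
move=> [sf [tf Tf Pf]] [sg [tg Tg Pg]]; split; first exact: pbS (pbD sf sg).
exists (fun a => 1 + (tf a + (1 + (tg a + 3))))%N.
  by do ![apply: pbD | apply: pb_const].
move=> N; have [p Hp] := Pf N.+1; have [q Hq] := Pg N.+2.
(* The input stays in [N] while [p] works at [N.+1], and the result of [p] stays in [N.+1] while [q]
   works at [N.+2]: each program spares the variables below its address. *)
exists (Seq (Assign N.+1 (EVar N)) (Seq p (Seq (Assign N.+2 (EVar N))
  (Seq q (Assign N (ENode (EVar N.+1) (EVar N.+2))))))) => s a Na.
have [s1 [t1 [E1 N1 F1 L1]]] := Hp (upd s N.+1 (s N)) a ltac:(by rewrite /upd eqxx).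
have FN : s1 N = s N by rewrite F1 // /upd ltn_eqF.
have [s2 [t2 [E2 N2 F2 L2]]] :=
  Hq (upd s1 N.+2 (s1 N)) a ltac:(by rewrite /upd eqxx FN).
eexists; eexists; split.
- do ![apply: exec_seq0; first exact: ExecAssign].
  apply: exec_seq0; first exact: E1.
  do ![apply: exec_seq0; first exact: ExecAssign].
  apply: exec_seq0; first exact: E2.
  exact: ExecAssign.
- by rewrite /upd eqxx /= N2 F2 // /upd ltn_eqF // N1.
- move=> i ltN; rewrite /upd ltn_eqF // F2; last lia.
  rewrite /upd ltn_eqF; last lia.
  by rewrite F1 /upd ?ltn_eqF //; lia.
- by rewrite /=; lia.
Qed.

Lemma pt_if B {EB : Enc B} (b : A -> bool) (f g : A -> B) :
  polytime b -> polytime f -> polytime g -> polytime (fun a => if b a then f a else g a).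
Proof.
move=> [_ [tb Tb Pb]] [sf [tf Tf Pf]] [sg [tg Tg Pg]]; split.
  by apply: pb_le (pbD sf sg) => a; case: (b a); rewrite ?leq_addl ?leq_addr.
exists (fun a => 1 + (tb a + (1 + (tf a + tg a))))%N.
  by do ![apply: pbD | apply: pb_const].
move=> N; have [r Hr] := Pb N.+1; have [p Hp] := Pf N; have [q Hq] := Pg N.
exists (Seq (Assign N.+1 (EVar N)) (Seq r (If (EVar N.+1) p q))) => s a Na.
have [s1 [t1 [E1 N1 F1 L1]]] := Hr (upd s N.+1 (s N)) a ltac:(by rewrite /upd eqxx).
have FN : s1 N = enc a by rewrite F1 // /upd ltn_eqF.
have [s2 [t2 [E2 N2 F2 L2]]] : exists s' t,
    [/\ exec (if b a then p else q) s1 [::] s' t,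
        s' N = enc (if b a then f a else g a),
        forall i, (i < N)%N -> s' i = s1 i & (t <= tf a + tg a)%N].
  case: (b a).
    by have [s2 [t2 [? ? ? ?]]] := Hp _ _ FN; exists s2, t2; split => //; lia.
  by have [s2 [t2 [? ? ? ?]]] := Hq _ _ FN; exists s2, t2; split => //; lia.
eexists; eexists; split.
- apply: exec_seq0; first exact: ExecAssign.
  apply: exec_seq0; first exact: E1.
  by apply: ExecIf; rewrite /= N1; move: E2; case: (b a) => /=; exact.
- exact: N2.
- move=> i ltN; rewrite F2 // F1 /upd ?ltn_eqF //; lia.
- by rewrite /=; lia.
Qed.

End Basic.

Section Lists.
Context {A : Type} {EA : Enc A}.

Lemma pt_cons B {EB : Enc B} (f : A -> B) (g : A -> seq B) :
  polytime f -> polytime g -> polytime (fun a => f a :: g a).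
Proof.
move=> Hf Hg.
have : polytime (fun x : B * seq B => x.1 :: x.2).
  apply: (@pt_expr _ _ _ _ _ EVar 1) => //.
  by apply: pb_le pb_size => -[b l].
by move=> H; apply: (pt_comp H (pt_pair Hf Hg)).
Qed.

(** A cons cell is a [Node], so [(a, y :: l)] and [(a, (y, l))] have the same tree. Each branch can
    start on the input as it stands, once [ERight] has told whether the list is empty. *)
Lemma pt_case B C {EB : Enc B} {EC : Enc C} (l : A -> seq B)
    (f : A -> C) (g : A * (B * seq B) -> C) :
  polytime l -> polytime f -> polytime g ->
  polytime (fun a => if l a is y :: l' then g (a, (y, l')) else f a).
Proof.
move=> Hl Hf Hg.
have H : polytime (fun x : A * seq B => if x.2 is y :: l' then g (x.1, (y, l')) else f x.1);
  last exact: (pt_comp H (pt_pair pt_id Hl)).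
have {Hl l} [sf [tf Tf Pf]] := pt_comp Hf (pt_fst (@pt_id (A * seq B) _)).
have [sg [tg Tg Pg]] := Hg.
have pb_cons h : polybounded h ->
  polybounded (fun x : A * seq B => if x.2 is y :: l' then h (x.1, (y, l')) else 0%N).
  by case=> e H; exists e => -[a [|y l]] //=; apply: H.
split.
  apply: pb_le (pbD sf (pb_cons _ sg)) => -[a [|y l]] /=; lia.
exists (fun x => 2 + (2 + tf x + if x.2 is y :: l' then tg (x.1, (y, l')) else 0))%N.
  by do ![apply: pbD | apply: pb_const | apply: pb_cons | by []].
move=> N; have [p Hp] := Pf N; have [q Hq] := Pg N.
exists (If (ERight (EVar N)) q p) => s [a [|y l]] Na.
  have [s2 [t2 [E2 N2 F2 L2]]] := Hp _ _ Na.
  exists s2, (2 + t2)%N; split => //=; last by move: L2; lia.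
  by apply: ExecIf; rewrite /= Na.
have [s2 [t2 [E2 N2 F2 L2]]] := Hq s (a, (y, l)) Na.
exists s2, (2 + t2)%N; split => //=; last by move: L2; lia.
by apply: ExecIf; rewrite /= Na.
Qed.

End Lists.

(** * Iteration along a list *)

Section Loop.
Context {A B S : Type} {EA : Enc A} {EB : Enc B} {ES : Enc S}.
Variable f : A * (seq B * S) -> S.

(** The step receives the whole remaining list, current element included, because its length tells
    the position in the traversal. *)
Fixpoint loop (a : A) (l : seq B) (s : S) : S :=
  if l is _ :: l' then loop a l' (f (a, (l, s))) else s.

(** Trees are shared, so a loop that doubles its state would build one of
    exponential size in linear time. *)
Definition slow_growth : Prop := exists e, forall (a : A) (l : seq B) (s : S),
  (esize (f (a, (l, s))) <= esize s + (esize (a, l)) ^ e)%N.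

Hypothesis grow : slow_growth.

Lemma esize_loop e :
  (forall (a : A) (l : seq B) (s : S), (esize (f (a, (l, s))) <= esize s + (esize (a, l)) ^ e)%N) ->
  forall (a : A) (l : seq B) (s : S),
  (esize (loop a l s) <= esize s + size l * (esize (a, l)) ^ e)%N.
Proof.
move=> H a l s; elim: l s => [|y l IH] s; first by rewrite leq_addr.
have le : (esize (a, l) ^ e <= esize (a, y :: l) ^ e)%N.
  by case: (e) => // d; rewrite leq_exp2r // !esize_pair esize_cons; lia.
move: (IH (f (a, (y :: l, s)))) (H a (y :: l) s) => /= h1 h2.
apply: leq_trans h1 _; rewrite mulSn.
have := leq_mul (leqnn (size l)) le; lia.
Qed.

(** The cost of the [While] loop in [pt_loop_core]: 1 for the test, 5 for packing the argument, [tm]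
    for the call, 1 and 2 for updating the state and the list. *)
Fixpoint loop_time (tm : A * (seq B * S) -> nat) a l s : nat :=
  if l is _ :: l' then
    (1 + (5 + (tm (a, (l, s)) + (1 + 2))) + loop_time tm a l' (f (a, (l, s))))%N
  else 1%N.

(** [M] bounds every argument ever passed to [f]. The second inequality is the loop invariant: a
    step may enlarge [s] by one summand, but [size l] then drops by one. Measuring increments by the
    fixed [l0] makes these summands equal. *)
Lemma loop_time_le tm e d :
  (forall (a : A) (l : seq B) (s : S), (esize (f (a, (l, s))) <= esize s + (esize (a, l)) ^ e)%N) ->
  (forall x, (tm x <= (esize x).+1 ^ d)%N) ->
  forall (a : A) (l0 l : seq B) (s : S) M, (esize l <= esize l0)%N ->
  (esize a + esize l0 + esize s + size l * esize (a, l0) ^ e + 2 < M)%N ->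
  (loop_time tm a l s <= (size l) * (9 + M ^ d) + 1)%N.
Proof.
move=> H T a l0 l s M; elim: l s => //= y l IH s; rewrite esize_cons => le leM.
have le1 : (esize (a, y :: l) ^ e <= esize (a, l0) ^ e)%N.
  by case: (e) => // i; rewrite leq_exp2r // !esize_pair esize_cons; lia.
have h1 := H a (y :: l) s; move: leM; rewrite mulSn => leM.
have {}IH := IH (f (a, (y :: l, s))) ltac:(lia) ltac:(lia).
have h2 : (tm (a, (y :: l, s)) <= M ^ d)%N.
  apply: leq_trans (T _) _; case: (d) => // i; rewrite leq_exp2r //.
  by rewrite !esize_pair esize_cons; lia.
rewrite mulSn; lia.
Qed.

Lemma pt_loop_core : polytime f ->
  polytime (fun x : A * (seq B * S) => loop x.1 x.2.1 x.2.2).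
Proof.
move=> [_ [tm [d T] P]]; have [e H] := grow.
have PM : polybounded (fun x : A * (seq B * S) => esize x + esize x * esize x ^ e)%N.
  by polyb.
have le1 (a : A) (l : seq B) (s : S) : (esize (a, l) <= esize (a, (l, s)))%N.
  by rewrite !esize_pair; lia.
have le2 (a : A) (l : seq B) (s : S) : (size l <= esize (a, (l, s)))%N.
  by apply: leq_trans (ltnW (size_esize l)) _; rewrite !esize_pair; lia.
have le3 (a : A) (l : seq B) (s : S) :
    (size l * esize (a, l) ^ e <= esize (a, (l, s)) * esize (a, (l, s)) ^ e)%N.
  by apply: leq_mul => //; case: (e) => // i; rewrite leq_exp2r.
split.
  apply: pb_le PM => -[a [l s]] /=; apply: leq_trans (esize_loop H _ _ _) _.
  by apply: leq_add (le3 a l s); rewrite !esize_pair; lia.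
exists (fun x => 2 + (3 + (3 + (loop_time tm x.1 x.2.1 x.2.2 + 1))))%N.
  have PT : polybounded (fun x : A * (seq B * S) =>
      esize x * (9 + (esize x + esize x * esize x ^ e + 3) ^ d) + 1)%N.
    by polyb.
  have PL : polybounded (fun x : A * (seq B * S) => loop_time tm x.1 x.2.1 x.2.2); last by polyb.
  apply: pb_le PT => -[a [l s]] /=.
  set M := (X in (9 + X ^ d)%N).
  apply: (@leq_trans (size l * (9 + M ^ d) + 1)%N); last first.
    by rewrite leq_add2r leq_mul2r; apply/orP; right; apply: le2.
  apply: (loop_time_le H T (leqnn _)); rewrite /M.
  move: (le3 a l s); set D1 := (size l * _)%N; set D2 := (_ * _ ^ _)%N.
  by rewrite !esize_pair; lia.
move=> N; have [p Hp] := P N.+4.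
(* [N.+1] holds the parameter, [N.+2] the remaining list, [N.+3] the state; [N.+4] is the address at
   which [p] is called. *)
pose body := Seq (Assign N.+4 (ENode (EVar N.+1) (ENode (EVar N.+2) (EVar N.+3))))
  (Seq p (Seq (Assign N.+3 (EVar N.+4)) (Assign N.+2 (ERight (EVar N.+2))))).
have W : forall a l s st, st N.+1 = enc a -> st N.+2 = enc l -> st N.+3 = enc s ->
  exists st' t, [/\ exec (While (EVar N.+2) body) st [::] st' t,
    st' N.+3 = enc (loop a l s), (t <= loop_time tm a l s)%N
    & forall i, (i < N)%N -> st' i = st i].
  move=> a; elim=> [|y l IH] s st Ha Hl Hs /=.
    by exists st, 1%N; split => //; apply: ExecStop; rewrite /= Hl.
  pose x := Node (st N.+1) (Node (st N.+2) (st N.+3)).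
  have [s1 [t1 [E1 N1 F1 L1]]] := Hp (upd st N.+4 x) (a, (y :: l, s))
    ltac:(by rewrite /upd eqxx /x Ha Hl Hs).
  pose s2 := upd s1 N.+3 (s1 N.+4).
  pose s3 := upd s2 N.+2 (if s2 N.+2 is Node _ z then z else Leaf).
  have Eb : exec body st [::] s3 (5 + (t1 + (1 + 2))).
    apply: exec_seq0; first exact: (ExecAssign _ _ (ENode _ (ENode _ _))).
    apply: exec_seq0; first exact: E1.
    by apply: exec_seq0; [exact: (ExecAssign _ _ (EVar _)) | exact: (ExecAssign _ _ (ERight _))].
  have k1 i : (i < N.+2)%N -> s3 i = st i.
    by move=> lt; rewrite /s3 /s2 /upd !ifN_eq ?F1 /upd ?ifN_eq //; lia.
  have [|||st' [t' [E' N' L' F']]] := IH (f (a, (y :: l, s))) s3.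
  - by rewrite k1.
  - rewrite /s3 /upd eqxx /s2 /upd ifN_eq; last lia.
    by rewrite F1 /upd ?ifN_eq ?Hl //; lia.
  - rewrite /s3 /upd ifN_eq; last lia.
    by rewrite /s2 /upd eqxx N1.
  exists st', (1 + (5 + (t1 + (1 + 2))) + t')%N; split => //; last first.
  - by move=> i lt; rewrite F' // k1 //; lia.
  - by lia.
  apply: (@ExecLoop (EVar N.+2) body st s3 st' [::] [::]) => //.
  by rewrite /= Hl.
exists (Seq (Assign N.+1 (ELeft (EVar N))) (Seq (Assign N.+2 (ELeft (ERight (EVar N))))
  (Seq (Assign N.+3 (ERight (ERight (EVar N)))) (Seq (While (EVar N.+2) body)
  (Assign N (EVar N.+3)))))) => st [a [l s]] Na.
pose (s1 := upd st N.+1 (enc a)); pose (s2 := upd s1 N.+2 (enc l)).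
pose (s3 := upd s2 N.+3 (enc s)).
have [|||st' [t' [E' N' L' F']]] := W a l s s3.
- by rewrite /s3 /s2 /s1 /upd eqxx !ltn_eqF //; lia.
- by rewrite /s3 /s2 /upd eqxx ltn_eqF.
- by rewrite /s3 /upd eqxx.
exists (upd st' N (st' N.+3)), (2 + (3 + (3 + (t' + 1))))%N; split.
- have e1 : s1 = upd st N.+1 (eval st (ELeft (EVar N))) by rewrite /= Na.
  have e2 : s2 = upd s1 N.+2 (eval s1 (ELeft (ERight (EVar N)))).
    by rewrite /= [s1 N]/upd ltn_eqF // Na.
  have e3 : s3 = upd s2 N.+3 (eval s2 (ERight (ERight (EVar N)))).
    by rewrite /= [s2 N]/upd ltn_eqF // [s1 N]/upd ltn_eqF // Na.
  apply: (@exec_seq0 _ _ _ s1 _ 2); first by rewrite e1; apply: ExecAssign.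
  apply: (@exec_seq0 _ _ _ s2 _ 3); first by rewrite e2; apply: ExecAssign.
  apply: (@exec_seq0 _ _ _ s3 _ 3); first by rewrite e3; apply: ExecAssign.
  by apply: exec_seq0; [exact: E' | exact: (ExecAssign _ _ (EVar _))].
- by rewrite /upd eqxx.
- move=> i lt; rewrite /upd ltn_eqF // F' //.
  by rewrite /s3 /s2 /s1 /upd !ltn_eqF //; lia.
- by move: L'; rewrite /=; lia.
Qed.

End Loop.

Ltac pt := match goal with
  | |- polytime (fun x => x) => exact: pt_id
  | |- polytime fst => apply: pt_fst; pt
  | |- polytime snd => apply: pt_snd; pt
  | |- polytime (fun x => (@?f x, @?g x)) => apply: pt_pair; pt
  | |- polytime (fun x => fst (@?f x)) => apply: (@pt_fst _ _ _ _ _ _ f); pt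
  | |- polytime (fun x => snd (@?f x)) => apply: (@pt_snd _ _ _ _ _ _ f); pt
  | |- polytime (fun x => cons (@?f x) (@?g x)) =>
      apply: (@pt_cons _ _ _ _ f g); pt
  | |- polytime (fun x => if _ then _ else _) => apply: pt_if; pt
  | |- polytime _ => first [exact: pt_const | by [] | idtac]
  end.

(** * Folds and list functions *)

Section Folds.
Context {X A B S : Type} {EX : Enc X} {EA : Enc A} {EB : Enc B} {ES : Enc S}.

Lemma pt_loop (f : A * (seq B * S) -> S) (a : X -> A) (l : X -> seq B) (s : X -> S) :
  slow_growth f -> polytime f -> polytime a -> polytime l -> polytime s ->
  polytime (fun x => loop f (a x) (l x) (s x)).
Proof.
move=> gf pf pa pl ps.
exact: (pt_comp (pt_loop_core gf pf) (pt_pair pa (pt_pair pl ps))).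
Qed.

Variable h : A * (B * S) -> S.

Definition fold_step (x : A * (seq B * S)) : S :=
  if x.2.1 is y :: _ then h (x.1, (y, x.2.2)) else x.2.2.

Lemma loop_fold_step a l s :
  loop fold_step a l s = foldl (fun s y => h (a, (y, s))) s l.
Proof. by elim: l s => //= y l IH s; rewrite IH. Qed.

Definition fold_growth : Prop := exists2 b : A * B -> nat, polybounded b &
  forall a y s, (esize (h (a, (y, s))) <= esize s + b (a, y))%N.

Lemma pt_foldl (a : X -> A) (l : X -> seq B) (s : X -> S) :
  fold_growth -> polytime h -> polytime a -> polytime l -> polytime s ->
  polytime (fun x => foldl (fun s y => h (a x, (y, s))) (s x) (l x)).
Proof.
move=> [b [e He] Hb] ph pa pl ps.
apply: (@pt_ext _ _ _ _ (fun x => loop fold_step (a x) (l x) (s x))).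
  by move=> x; rewrite loop_fold_step.
apply: pt_loop => //.
  exists e => a0 [|y l0] s0; first by rewrite leq_addr.
  apply: leq_trans (Hb _ _ _) _; rewrite leq_add2l.
  apply: leq_trans (He _) _; case: (e) => // i; rewrite leq_exp2r //.
  by rewrite !esize_pair esize_cons /=; lia.
apply: (@pt_case _ _ B S _ _ (fun x => x.2.1) (fun x => x.2.2)
  (fun x => h (x.1.1, (x.2.1, x.1.2.2)))); [by pt | by pt | ].
by apply: (pt_comp ph); pt.
Qed.

End Folds.

Lemma fold_growth_const A B S {EA : Enc A} {EB : Enc B} {ES : Enc S}
    (h : A * (B * S) -> S) c :
  (forall a y s, (esize (h (a, (y, s))) <= esize s + esize y + c)%N) -> fold_growth h.
Proof.
move=> H; exists (fun x => esize x.2 + c)%N => [|a y s]; last by rewrite addnA H.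
apply: pbD (pb_const c); apply: pb_le pb_size => -[a y].
by rewrite esize_pair /=; lia.
Qed.

Lemma esize_cat A {EA : Enc A} (l1 l2 : seq A) :
  (esize (l1 ++ l2) <= esize l1 + esize l2)%N.
Proof. by elim: l1 => [|y l IH]; rewrite /= ?esize_cons; lia. Qed.

Section ListFunctions.
Context {X A B S : Type} {EX : Enc X} {EA : Enc A} {EB : Enc B} {ES : Enc S}.
Implicit Types (l : X -> seq B) (a : X -> A).

Lemma pt_catrev l1 l2 :
  polytime l1 -> polytime l2 -> polytime (fun x => catrev (l1 x) (l2 x)).
Proof.
move=> p1 p2.
have E x : foldl (fun (s : seq B) y => y :: s) (l2 x) (l1 x) = catrev (l1 x) (l2 x).
  by elim: (l1 x) (l2 x) => //= y l IH s; rewrite IH.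
apply: (pt_ext E).
apply: (@pt_foldl _ unit _ _ _ _ _ _ (fun x => x.2.1 :: x.2.2) (fun=> tt)) => //; try pt.
by apply: (@fold_growth_const _ _ _ _ _ _ _ 1) => u y s; rewrite esize_cons /=; lia.
Qed.

Lemma pt_rev l : polytime l -> polytime (fun x => rev (l x)).
Proof. by move=> p; apply: pt_catrev => //; pt. Qed.

Lemma pt_cat l1 l2 :
  polytime l1 -> polytime l2 -> polytime (fun x => l1 x ++ l2 x).
Proof.
move=> p1 p2; apply: (@pt_ext _ _ _ _ (fun x => catrev (rev (l1 x)) (l2 x))).
  by move=> x; rewrite catrevE revK.
by apply: pt_catrev => //; apply: pt_rev.
Qed.

Lemma pt_foldr (h : A * (B * S) -> S) a l (s : X -> S) :
  fold_growth h -> polytime h -> polytime a -> polytime l -> polytime s ->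
  polytime (fun x => foldr (fun y s => h (a x, (y, s))) (s x) (l x)).
Proof.
move=> gh ph pa pl ps.
apply: (@pt_ext _ _ _ _ (fun x => foldl (fun s y => h (a x, (y, s))) (s x) (rev (l x)))).
  by move=> x; rewrite foldl_rev.
by apply: pt_foldl => //; apply: pt_rev.
Qed.

End ListFunctions.

Lemma pt_flatmap X A B C {EX : Enc X} {EA : Enc A} {EB : Enc B} {EC : Enc C}
    (h : A * B -> seq C) (a : X -> A) (l : X -> seq B) :
  polytime h -> polytime a -> polytime l ->
  polytime (fun x => flatten [seq h (a x, y) | y <- l x]).
Proof.
move=> ph pa pl.
apply: (@pt_ext _ _ _ _ (fun x => foldr (fun y s => h (a x, y) ++ s) [::] (l x))).
  by move=> x; elim: (l x) => //= y l' ->.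
apply: (@pt_foldr _ _ _ _ _ _ _ _ (fun x => h (x.1, x.2.1) ++ x.2.2)) => //; last by pt.
  exists (fun x => esize (h x)) => [|a0 y s]; first by case: ph.
  by rewrite addnC; apply: esize_cat.
by apply: pt_cat; last pt; apply: (pt_comp ph); pt.
Qed.

Lemma pt_map X A B C {EX : Enc X} {EA : Enc A} {EB : Enc B} {EC : Enc C}
    (h : A * B -> C) (a : X -> A) (l : X -> seq B) :
  polytime h -> polytime a -> polytime l ->
  polytime (fun x => [seq h (a x, y) | y <- l x]).
Proof.
move=> ph pa pl.
apply: (@pt_ext _ _ _ _ (fun x => flatten [seq [:: h (a x, y)] | y <- l x])).
  by move=> x; rewrite flatten_map1.
by apply: (@pt_flatmap _ _ _ _ _ _ _ _ (fun x => [:: h x])) => //; by pt.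
Qed.

Lemma pt_nseq X B C {EX : Enc X} {EB : Enc B} {EC : Enc C} (l : X -> seq B) (c : C) :
  polytime l -> polytime (fun x => nseq (size (l x)) c).
Proof.
move=> pl; apply: (@pt_ext _ _ _ _ (fun x => [seq c | _ <- l x])).
  by move=> x; elim: (l x) => //= y l' ->.
by apply: (@pt_map _ unit _ _ _ _ _ _ (fun=> c) (fun=> tt)) => //; by pt.
Qed.

(** A fold over the first list whose state holds the reversed output and the unread part of the
    second list. Once that part is empty the output no longer changes. *)
Lemma pt_zip X B C {EX : Enc X} {EB : Enc B} {EC : Enc C}
    (l1 : X -> seq B) (l2 : X -> seq C) :
  polytime l1 -> polytime l2 -> polytime (fun x => zip (l1 x) (l2 x)).
Proof.
move=> p1 p2.
pose h (x : unit * (B * (seq (B * C) * seq C))) : seq (B * C) * seq C :=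
  if x.2.2.2 is z :: r then ((x.2.1, z) :: x.2.2.1, r) else (x.2.2.1, [::]).
have E b o r : (foldl (fun s y => h (tt, (y, s))) (o, r) b).1 = catrev (zip b r) o.
  elim: b o r => [|y b IH] o [|z r] //=; rewrite IH //=.
  by case: (b).
apply: (@pt_ext _ _ _ _
  (fun x => rev (foldl (fun s y => h (tt, (y, s))) ([::], l2 x) (l1 x)).1)).
  by move=> x; rewrite E catrevE cats0 revK.
apply/pt_rev/pt_fst.
apply: (@pt_foldl _ _ _ _ _ _ _ _ h (fun=> tt)) => //; try pt.
  apply: (@fold_growth_const _ _ _ _ _ _ _ 1) => u y [w [|z r]]; rewrite /h /=.
    by rewrite !esize_pair; lia.
  by rewrite !esize_pair !esize_cons esize_pair; lia.
apply: (@pt_case _ _ C _ _ _ (fun x => x.2.2.2) (fun x => (x.2.2.1, [::]))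
  (fun x => ((x.1.2.1, x.2.1) :: x.1.2.2.1, x.2.2))); by pt.
Qed.

(** [q] is a constant, so the comparison unrolls into [q] nested case distinctions and needs no
    arithmetic. *)
Lemma pt_size_lt X B {EX : Enc X} {EB : Enc B} (l : X -> seq B) q :
  polytime l -> polytime (fun x => (size (l x) < q)%N).
Proof.
elim: q X EX l => [|q IH] X EX l pl.
  by apply: (@pt_ext _ _ _ _ (fun=> false)); [by move=> x; rewrite ltn0 | pt].
apply: (@pt_ext _ _ _ _ (fun x => if l x is y :: l' then (size l' < q)%N else true)).
  by move=> x; case: (l x).
apply: (@pt_case _ _ B bool _ _ l (fun=> true) (fun x => (size x.2.2 < q)%N)) => //; try pt.
by apply: IH; pt.
Qed.

(** * Binary counting *)

Lemma esize_true : esize true = 3. Proof. by []. Qed.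
Lemma esize_false : esize false = 1. Proof. by []. Qed.

Fixpoint inc (d : seq bool) : seq bool :=
  if d is b :: d' then (if b then false :: inc d' else true :: d') else [:: true].

Lemma nat_digitsS n : nat_digits n.+1 = inc (nat_digits n).
Proof.
have pos p : pos_digits (BinPos.Pos.succ p) = inc (pos_digits p).
  by elim: p => //= p ->.
rewrite /nat_digits; have -> : bin_of_nat n.+1 = BinNat.N.succ (bin_of_nat n).
  apply: (can_inj nat_of_binK); rewrite bin_of_natK.
  rewrite -{1}[n]bin_of_natK; case: (bin_of_nat n) => //= p.
  by elim: p => //= p; rewrite !natTrecE => <-; rewrite doubleS.
by case: (bin_of_nat n) => //= p; rewrite pos.
Qed.

(** [inc] as a left fold: the state is the pending carry and the digits produced so far, in reverse.
    A carry left at the end becomes a new top digit. *)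
Definition carry_step (x : unit * (bool * (bool * seq bool))) : bool * seq bool :=
  if x.2.2.1 then (if x.2.1 then (true, false :: x.2.2.2) else (false, true :: x.2.2.2))
  else (false, x.2.1 :: x.2.2.2).

Lemma pt_inc X {EX : Enc X} (d : X -> seq bool) :
  polytime d -> polytime (fun x => inc (d x)).
Proof.
move=> pd.
have E l c w : rev (let st := foldl (fun s b => carry_step (tt, (b, s))) (c, w) l in
    if st.1 then true :: st.2 else st.2) = rev w ++ (if c then inc l else l).
  elim: l c w => [|b l IH] c w /=.
    by case: c; rewrite ?rev_cons -?cats1 ?cats0.
  by case: c; case: b; rewrite /carry_step /= IH rev_cons cat_rcons.
pose st x := foldl (fun s b => carry_step (tt, (b, s))) (true, [::]) (d x).
apply: (@pt_ext _ _ _ _ (fun x => rev (if (st x).1 then true :: (st x).2 else (st x).2))).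
  by move=> x; rewrite E.
have pst : polytime st.
  apply: (@pt_foldl _ _ _ _ _ _ _ _ carry_step (fun=> tt)) => //; try pt.
    apply: (@fold_growth_const _ _ _ _ _ _ _ 9) => u b [c w]; rewrite /carry_step.
    by case: c; case: b; rewrite /= !esize_pair ?esize_cons ?esize_true ?esize_false; lia.
  by rewrite /carry_step; pt.
by apply: pt_rev; pt.
Qed.

(** The length is converted to binary by one increment per list element, starting from [[:: true]],
    the digits of 1. *)
Lemma pt_digits X C {EX : Enc X} {EC : Enc C} (l : X -> seq C) :
  polytime l -> polytime (fun x => nat_digits (size (l x)).+1).
Proof.
move=> pl.
apply: (@pt_ext _ _ _ _ (fun x => foldr (fun _ d => inc d) [:: true] (l x))).
  by move=> x; elim: (l x) => [|y l' IH] //=; rewrite IH -nat_digitsS.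
apply: (@pt_foldr _ _ _ _ _ _ _ _ (fun x => inc x.2.2) (fun=> tt)) => //; try pt.
  apply: (@fold_growth_const _ _ _ _ _ _ _ 4) => u y s /=.
  rewrite -addnA [(_ + 4)%N]addnC addnA; apply: leq_trans (leq_addr _ _).
  by elim: s => [|[] s IH] //=; rewrite !esize_cons ?esize_true ?esize_false; lia.
by apply: pt_inc; pt.
Qed.

(** Applied to unary lists this is truncated subtraction, as required by the padding in [onehot]. *)
Lemma pt_drop X B C {EX : Enc X} {EB : Enc B} {EC : Enc C} (l : X -> seq B)
    (w : X -> seq C) :
  polytime l -> polytime w -> polytime (fun x => drop (size (l x)) (w x)).
Proof.
move=> pl pw.
apply: (@pt_ext _ _ _ _ (fun x => foldr (fun _ s => behead s) (w x) (l x))).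
  by move=> x; elim: (l x) => [|y l' IH] /=; rewrite ?drop0 // IH -drop1 drop_drop.
apply: (@pt_foldr _ _ _ _ _ _ _ _ (fun x => behead x.2.2) (fun=> tt)) => //; try pt.
  apply: (@fold_growth_const _ _ _ _ _ _ _ 0) => u y [|z s] /=.
    by lia.
  by rewrite !esize_cons; lia.
apply: (@pt_ext _ _ _ _ (fun x => if x.2.2 is y :: l' then l' else [::])).
  by move=> [? [? []]].
by apply: (@pt_case _ _ C _ _ _ (fun x => x.2.2) (fun=> [::]) (fun x => x.2.2)); pt.
Qed.

(** * The reduction *)

(** Built from the right: for positive [q] only the first chunk can be smaller than [q], and the
    function is a plain [foldr]. *)
Fixpoint chunks (T : Type) (q : nat) (l : seq T) : seq (seq T) :=
  if l is y :: l' then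
    if chunks q l' is c :: cs then
      (if size c < q then (y :: c) :: cs else [:: y] :: c :: cs)%N
    else [:: [:: y]]
  else [::].

Definition row_or (u v : seq bool) : seq bool := [seq p.1 || p.2 | p <- zip u v].

(** The first [q] entries of a row record which of the sets in [B] it unites. *)
Fixpoint choices (q : nat) (z : seq bool) (B : seq (seq bool)) : seq (seq bool) :=
  if q is q'.+1 then
    if B is s :: B' then
      flatten [seq [:: false :: r; true :: row_or (nseq q' false ++ s) r]
              | r <- choices q' z B']
    else [seq false :: r | r <- choices q' z [::]]
  else [:: z].

Definition onehot (m j : nat) : seq bool :=
  nseq j false ++ true :: nseq (m - j.+1) false.

(** Every row lists, in this order, the [m] tags, the mark, the [q] record entries and the [n]
    original elements. *)
Definition block_rows q z m j B : seq (seq bool) :=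
  [seq onehot m j ++ false :: r | r <- choices q z B].

Definition last_row q (z : seq bool) m : seq bool :=
  nseq m false ++ true :: nseq q true ++ z.

Definition all_rows q z (Bs : seq (seq (seq bool))) : seq (seq bool) :=
  flatten [seq block_rows q z (size Bs) j (nth [::] Bs j) | j <- iota 0 (size Bs)]
  ++ [:: last_row q z (size Bs)].

(** The target exceeds the number of chunks by one, for the last row. The new universe gets its
    length from that row, so no lengths need to be added. *)
Definition reduction q (x : seq unit * seq (seq bool)) :
    seq bool * (seq unit * seq (seq bool)) :=
  let Bs := chunks q x.2 in
  let z := nseq (size x.1) false in
  (nat_digits (size Bs).+1,
   (nseq (size (last_row q z (size Bs))) tt, all_rows q z (rev Bs))).

(** * The reduction runs in polynomial time *)

Lemma pt_chunks X T {EX : Enc X} {ET : Enc T} q (l : X -> seq T) :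
  polytime l -> polytime (fun x => chunks q (l x)).
Proof.
move=> pl.
pose h (x : unit * (T * seq (seq T))) : seq (seq T) :=
  if x.2.2 is c :: cs then
    if (size c < q)%N then (x.2.1 :: c) :: cs else [:: x.2.1] :: c :: cs
  else [:: [:: x.2.1]].
apply: (@pt_ext _ _ _ _ (fun x => foldr (fun y s => h (tt, (y, s))) [::] (l x))).
  by move=> x; elim: (l x) => //= y l' ->; case: (chunks q l').
apply: (@pt_foldr _ _ _ _ _ _ _ _ h (fun=> tt)) => //; try pt.
  apply: (@fold_growth_const _ _ _ _ _ _ _ 9) => u y [|c s] /=; rewrite /h /=.
    by rewrite !esize_cons !esize_nil; lia.
  by case: ifP => _; rewrite !esize_cons ?esize_nil; lia.
apply: (@pt_case _ _ (seq T) _ _ _ (fun x => x.2.2) (fun x => [:: [:: x.2.1]])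
  (fun x => if (size x.2.1 < q)%N then (x.1.2.1 :: x.2.1) :: x.2.2
            else [:: x.1.2.1] :: x.2.1 :: x.2.2)); [by pt | by pt | ].
by apply: pt_if; [apply: pt_size_lt | |]; pt.
Qed.

Lemma pt_row_or X {EX : Enc X} (u v : X -> seq bool) :
  polytime u -> polytime v -> polytime (fun x => row_or (u x) (v x)).
Proof.
move=> pu pv.
apply: (@pt_map _ unit _ _ _ _ _ _ (fun y => y.2.1 || y.2.2) (fun=> tt)) => //.
- by apply: (@pt_ext _ _ _ _ (fun y => if y.2.1 then true else y.2.2)); [move=> [? [[] []]] | pt].
- by pt.
- exact: pt_zip.
Qed.

(** The recursion on the constant [q] becomes a fixed nesting of programs. Each level at most
    doubles the number of rows, in total a constant factor. *)
Lemma pt_choices X {EX : Enc X} q z B : polytime z -> polytime B ->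
  polytime (fun x : X => choices q (z x) (B x)).
Proof.
elim: q X EX z B => [|q IH] X EX z B pz pB /=; first by pt.
apply: (@pt_case _ _ (seq bool) _ _ _ B (fun x => [seq false :: r | r <- choices q (z x) [::]])
  (fun y => flatten [seq [:: false :: r; true :: row_or (nseq q false ++ y.2.1) r]
              | r <- choices q (z y.1) y.2.2])) => //.
  apply: (@pt_map _ unit _ _ _ _ _ _ (fun x => false :: x.2) (fun=> tt)); [by pt | by pt |].
  by apply: IH => //; pt.
apply: (@pt_flatmap _ _ _ _ _ _ _ _
  (fun x => [:: false :: x.2; true :: row_or (nseq q false ++ x.1) x.2]) (fun y => y.2.1)).
- apply: pt_cons; first by pt.
  apply: pt_cons; last by pt.
  apply: pt_cons; first by pt.
  by apply: pt_row_or; [apply: pt_cat; pt | pt].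
- by pt.
- by apply: IH; [apply: (pt_comp pz); pt | pt].
Qed.

(** A loop over [l] sees the suffixes of [l]: the chunk followed by [j] others is
    tagged with [j], whence the [rev] in [reduction]. *)
Definition suffix_rows q (x : seq bool * seq (seq (seq bool)) * seq (seq (seq bool))) :
    seq (seq bool) :=
  if x.2 is B :: l then block_rows q x.1.1 (size x.1.2) (size l) B else [::].

Lemma pt_suffix_rows q : polytime (suffix_rows q).
Proof.
apply: (@pt_case _ _ (seq (seq bool)) _ _ _ snd (fun=> [::])
  (fun x => block_rows q x.1.1.1 (size x.1.1.2) (size x.2.2) x.2.1)); [by pt | by pt |].
apply: (@pt_map _ (seq bool) _ _ _ _ _ _ (fun y => y.1 ++ false :: y.2)
  (fun x => onehot (size x.1.1.2) (size x.2.2)) (fun x => choices q x.1.1.1 x.2.1)).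
- by apply: pt_cat; pt.
- apply: pt_cat; first by apply: pt_nseq; pt.
  apply: pt_cons; first by pt.
  apply: (@pt_ext _ _ _ _ (fun x =>
    nseq (size (drop (size (tt :: nseq (size x.2.2) tt)) x.1.1.2)) false)).
    by move=> x; rewrite size_drop /= size_nseq.
  apply/pt_nseq/pt_drop; last by pt.
  by apply: pt_cons; [pt | apply: pt_nseq; pt].
- by apply: pt_choices; pt.
Qed.

Lemma pt_all_rows X {EX : Enc X} q z Bs : polytime z -> polytime Bs ->
  polytime (fun x : X => all_rows q (z x) (rev (Bs x))).
Proof.
move=> pz pB.
pose f x : seq (seq bool) := suffix_rows q (x.1, x.2.1) ++ x.2.2.
(* The chunk met first has the largest index and each block is put in front of the later ones, so
   the blocks end up in increasing order of [j]. *)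
have E z0 w l s : loop f (z0, w) l s =
    flatten [seq block_rows q z0 (size w) j (nth [::] (rev l) j) | j <- iota 0 (size l)] ++ s.
  elim: l s => [//|B l IH s]; rewrite [LHS]/= {}IH /f /suffix_rows [size (_ :: _)]/=.
  rewrite -[(size l).+1]addn1 iotaD map_cat flatten_cat /= add0n cats0 -catA.
  congr (flatten _ ++ (_ ++ _)).
    apply/eq_in_map => j; rewrite mem_iota => /andP[_ lt].
    by rewrite rev_cons nth_rcons size_rev lt.
  by rewrite rev_cons nth_rcons size_rev ltnn eqxx.
apply: (@pt_ext _ _ _ _ (fun x => loop f (z x, Bs x) (Bs x) [:: last_row q (z x) (size (Bs x))])).
  by move=> x; rewrite E /all_rows size_rev.
apply: (@pt_loop _ (seq bool * seq (seq (seq bool)))) => //.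
- have [[e H] _] := pt_suffix_rows q.
  (* [slow_growth] has no successor in its base. The size of a pair is some [x >= 2], hence
     [x + 1 <= x ^ 2], and doubling the exponent makes up for it. *)
  exists (2 * e)%N => a l s; rewrite /f addnC; apply: leq_trans (esize_cat _ _) _.
  rewrite leq_add2r; apply: leq_trans (H _) _; rewrite expnM; case: (e) => // i.
  have h : (1 < esize (a, l))%N by rewrite esize_pair ltnS addn_gt0 esize_gt0.
  rewrite leq_exp2r // -mulnn; apply: (@leq_trans (2 * esize (a, l))%N).
    by rewrite mul2n -addnn -addn1 leq_add2l ltnW.
  by rewrite leq_mul2r h orbT.
- by apply: pt_cat; [apply: (pt_comp (pt_suffix_rows q)); pt | pt].
- by pt.
- apply: pt_cons; last by pt.
  apply: pt_cat; first exact: pt_nseq.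
  apply: pt_cons; first by pt.
  by apply: pt_cat => //; pt.
Qed.

Lemma pt_reduction q : polytime (reduction q).
Proof.
have pB : polytime (fun x : seq unit * seq (seq bool) => chunks q x.2).
  by apply: pt_chunks; pt.
have pz : polytime (fun x : seq unit * seq (seq bool) => nseq (size x.1) false).
  by apply: pt_nseq; pt.
apply: pt_pair; first exact: pt_digits.
apply: pt_pair; last exact: pt_all_rows.
apply: pt_nseq; apply: pt_cat; first exact: pt_nseq.
by apply: pt_cons; [pt | apply: pt_cat => //; pt].
Qed.

(** At address 0 the argument is the program's input. Wiping all other written variables restores a
    store of the form [init], from which the next program can be started. *)
Lemma pt_program A B {EA : Enc A} {EB : Enc B} (f : A -> B) : polytime f ->
  exists p e, forall a, exists2 t, exec p (init (enc a)) [::] (init (enc (f a))) t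
    & (t <= (esize a).+1 ^ e)%N.
Proof.
move=> [_ [tm Tm P]]; have [p Hp] := P 0%N.
have [e He] := pbD Tm (pb_const (written_below p).+1).
exists (Seq p (clear (written_below p))), e => a.
have [s [t [E N0 _ L]]] := Hp (init (enc a)) a erefl.
exists (t + (written_below p).+1)%N; last by apply: leq_trans (He a); rewrite leq_add2r.
apply: (exec_seq0 E).
have -> : init (enc (f a)) = fun i => if (0 < i <= written_below p)%N then Leaf else s i.
  apply/funext => i; rewrite /init /upd; case: i => [|i] /=; first by rewrite N0.
  case: ltnP => // lt; rewrite (exec_frame (i := i.+1) E) //; lia.
exact: exec_clear.
Qed.

(** * Covers that take one set from every block *)

Section Selection.
Variables (T U : finType) (m : nat) (F : {set {set T}}).
Variables (block : 'I_m -> pred {set T}) (tag : 'I_m -> U) (mark : U).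
Variables (slot : 'I_m -> {set T} -> U) (elt : T -> U).
Variables (G : {set {set T}} -> 'I_m -> {set U}) (Z : {set U}).
Hypothesis block_F : forall S, S \in F -> exists j, block j S.
Hypothesis F_block : forall j S, block j S -> S \in F.
Hypothesis block_inj : forall j i S, block j S -> block i S -> j = i.
Hypothesis points : forall v, [\/ exists j, v = tag j, v \in Z | exists u, v = elt u].
Hypothesis tag_Z : forall j, tag j \notin Z.
Hypothesis mark_Z : mark \in Z.
Hypothesis elt_Z : forall u, elt u \notin Z.
Hypothesis tag_G : forall X j i, (tag i \in G X j) = (i == j).
Hypothesis mark_G : forall X j, mark \notin G X j.
Hypothesis slot_G : forall X j S, block j S -> (slot j S \in G X j) = (S \in X).
Hypothesis elt_G : forall X j u,
  (elt u \in G X j) = [exists S, [&& block j S, S \in X & u \in S]].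
Hypothesis eq_G : forall (X Y : {set {set T}}) j,
  (forall S, block j S -> (S \in X) = (S \in Y)) -> G X j = G Y j.

Local Open Scope set_scope.

(** Here [X] ranges over all subfamilies rather than subsets of one block. By [eq_G] only its part
    inside the block counts, and repetitions vanish in a set. *)
Definition selection_family : {set {set U}} :=
  Z |: [set G x.1 x.2 | x : {set {set T}} * 'I_m].

(** The bijection behind the reduction: block [j] contributes the set for the members of [C] in it,
    possibly none, and [Z] is always added. *)
Let Phi (C : {set {set T}}) : {set {set U}} := Z |: [set G C j | j : 'I_m].

Lemma G_inj X Y i j : G X i = G Y j -> i = j.
Proof. by move=> E; apply/eqP; rewrite -(tag_G Y j i) -E tag_G. Qed.

Lemma G_neq_Z X j : G X j != Z.
Proof. by apply/eqP => E; move: (mark_G X j); rewrite E mark_Z. Qed.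

Lemma Z_notin X : Z \notin [set G X j | j : 'I_m].
Proof. by apply/imsetP => -[j _ /esym/eqP]; apply/negP/G_neq_Z. Qed.

Lemma card_Phi C : #|Phi C| = m.+1.
Proof.
rewrite cardsU1 Z_notin card_in_imset ?card_ord // => i j _ _; exact: G_inj.
Qed.

Lemma sub_Phi C : Phi C \subset selection_family.
Proof.
apply: finset.setUS; apply/fintype.subsetP => _ /imsetP[j _ ->].
by apply/imsetP; exists (C, j).
Qed.

Lemma cover_Phi (C : {set {set T}}) : C \subset F ->
  (finset.cover (Phi C) == [set: U]) = (finset.cover C == [set: T]).
Proof.
move=> /fintype.subsetP sC; apply/eqP/eqP => H; apply/setP => v; rewrite [RHS]inE.
  have : elt v \in finset.cover (Phi C) by rewrite H inE.
  case/bigcupP => r /setU1P[-> |/imsetP[j _ ->]]; first by rewrite (negPf (elt_Z _)).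
  rewrite elt_G => /existsP[S /and3P[_ SC vS]].
  by apply/bigcupP; exists S.
apply/bigcupP; have ZP : Z \in Phi C by exact: setU11.
have GP j : G C j \in Phi C by apply/setU1P; right; apply: imset_f.
case: (points v) => [[j ->]|vZ|[u ->]].
- by exists (G C j) => //; rewrite tag_G.
- by exists Z.
- have : u \in finset.cover C by rewrite H inE.
  case/bigcupP => S SC uS; have [j bj] := block_F (sC _ SC).
  exists (G C j) => //; rewrite elt_G; apply/existsP; exists S.
  by rewrite bj SC uS.
Qed.

(** The tag tells which member of [Phi C] belongs to block [j], and the slots of that member spell
    out which sets of the block lie in [C]. *)
Lemma Phi_inj : {in [pred C : {set {set T}} | C \subset F] &, injective Phi}.
Proof.
move=> C D /fintype.subsetP sC /fintype.subsetP sD E; apply/setP => S.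
have [SF|nSF] := boolP (S \in F); last first.
  by rewrite (contraNF (@sC S)) // (contraNF (@sD S)).
have [j bj] := block_F SF.
have : G C j \in Phi D by rewrite -E; apply/setU1P; right; apply: imset_f.
case/setU1P => [/eqP|/imsetP[i _ Eij]]; first by rewrite (negPf (G_neq_Z _ _)).
by rewrite -(slot_G C bj) Eij -(G_inj Eij) slot_G.
Qed.

Lemma Phi_surj (D : {set {set U}}) :
  D \subset selection_family -> finset.cover D = [set: U] -> #|D| = m.+1 ->
  exists2 C : {set {set T}}, C \subset F & D = Phi C.
Proof.
move=> /fintype.subsetP sD cD mD.
have ZD : Z \in D.
  have : mark \in finset.cover D by rewrite cD inE.
  case/bigcupP => r rD; case/setU1P: (sD _ rD) => [<- //|/imsetP[x _ ->]].
  by rewrite (negPf (mark_G _ _)).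
have /choice[X HX] : forall j, exists X, G X j \in D.
  move=> j; have : tag j \in finset.cover D by rewrite cD inE.
  case/bigcupP => r rD; case/setU1P: (sD _ rD) => [->|/imsetP[x _ Er]].
    by rewrite (negPf (tag_Z _)).
  by rewrite Er tag_G => /eqP ->; exists x.1; rewrite -Er.
(* The choices [X j] made for the separate blocks are glued, each being consulted only inside its
   own block. *)
exists [set S in F | [exists j, block j S && (S \in X j)]].
  by apply/fintype.subsetP => S; rewrite inE => /andP[].
(* [mark] forces [Z] into [D] and each tag forces a set of its block. These are already [m.+1] sets,
   so the inclusion of [Phi C] in [D] is an equality. *)
set C := [set S in F | _]; apply/esym/eqP; rewrite eqEcard mD card_Phi leqnn andbT.
apply/fintype.subsetP => _ /setU1P[-> //|/imsetP[j _ ->]].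
rewrite (@eq_G C (X j)) // => S bj; rewrite inE (F_block bj) /=.
apply/existsP/idP => [[i /andP[bi]]|SX]; first by rewrite (block_inj bi bj).
by exists j; rewrite bj.
Qed.

Lemma card_selections :
  #|[set D : {set {set U}} | (D \subset selection_family)
       && (finset.cover D == [set: U]) && (#|D| == m.+1)]| =
  #|[set C : {set {set T}} | (C \subset F) && (finset.cover C == [set: T])]|.
Proof.
set A := [set C : {set {set T}} | _ && _]; rewrite -(card_in_imset (f := Phi) (D := mem A)).
  apply: eq_card => D; rewrite inE; apply/idP/imsetP.
    move=> /andP[/andP[sD /eqP cD] /eqP mD]; have [C sC E] := Phi_surj sD cD mD.
    by exists C => //; rewrite inE sC -cover_Phi // -E cD /=.
  case=> C; rewrite inE => /andP[sC cC] ->.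
  by rewrite sub_Phi cover_Phi // cC card_Phi /=.
by move=> C D; rewrite !inE => /andP[sC _] /andP[sD _]; apply: Phi_inj.
Qed.

End Selection.

(** * The reduced instance *)

Section Chunks.
Variables (T : eqType) (q : nat).
Hypothesis q_gt0 : (0 < q)%N.

Lemma flatten_chunks (l : seq T) : flatten (chunks q l) = l.
Proof.
elim: l => //= y l; case: (chunks q l) => [|c cs] /= E; first by rewrite -E.
by case: ifP => _ /=; rewrite E.
Qed.

Lemma size_chunk (l : seq T) c : c \in chunks q l -> (size c <= q)%N.
Proof.
elim: l c => //= y l; case: (chunks q l) => [_ c|c0 cs IH c].
  by rewrite inE => /eqP ->.
case: ifP => lt; rewrite inE => /predU1P[-> //|cin]; apply: IH => //.
by rewrite inE cin orbT.
Qed.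

(** All chunks after the first are full; the summand [q] pays for the first one. *)
Lemma size_chunks (l : seq T) : (q * size (chunks q l) <= size l + q)%N.
Proof.
suff : if chunks q l is c :: cs then
    (0 < size c)%N && (size l == size c + q * size cs)%N else true.
  case: (chunks q l) => [|c cs] /=; first by rewrite muln0.
  by move=> /andP[c0 /eqP ->]; rewrite mulnS; lia.
elim: l => //= y l; case E: (chunks q l) => [|c cs] /=.
  by move: (flatten_chunks l); rewrite E /= => <- _; rewrite muln0.
move=> /andP[c0 /eqP ->]; case: ifP => /= lt; first by lia.
have : (size c <= q)%N by apply: (@size_chunk l); rewrite E mem_head.
by rewrite mulnS; lia.
Qed.

Lemma chunks_map (T' : Type) (f : T' -> T) l :
  chunks q (map f l) = map (map f) (chunks q l).
Proof.
elim: l => //= y l ->; case: (chunks q l) => [|c cs] //=.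
by rewrite size_map; case: ifP.
Qed.

End Chunks.

(** * Sets as rows of bits *)

Definition bits n (S : {set 'I_n}) : seq bool := [seq i \in S | i <- enum 'I_n].

Definition set_of_bits n (r : seq bool) : {set 'I_n} := [set i : 'I_n | nth false r i]%SET.

Lemma size_bits n (S : {set 'I_n}) : size (bits S) = n.
Proof. by rewrite size_map size_enum_ord. Qed.

Lemma enc_bits n (S : {set 'I_n}) : enc (bits S) = set_tree S.
Proof. by rewrite /set_tree /bits /enc /enc_seq -map_comp. Qed.

Lemma nth_bits n (S : {set 'I_n}) (i : 'I_n) : nth false (bits S) i = (i \in S).
Proof. by rewrite (nth_map i) ?size_enum_ord // nth_ord_enum. Qed.

Lemma bits_set_of_bits n r : size r = n -> bits (set_of_bits n r) = r.
Proof.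
move=> sr; apply: (@eq_from_nth _ false); first by rewrite size_bits.
by move=> i; rewrite size_bits => lt; rewrite (nth_bits _ (Ordinal lt)) inE.
Qed.

Lemma bits_set0 n : bits (finset.set0 : {set 'I_n}) = nseq n false.
Proof.
apply: (@eq_from_nth _ false) => [|i]; rewrite size_bits ?size_nseq // => lt.
by rewrite (nth_bits _ (Ordinal lt)) inE nth_nseq lt.
Qed.

Lemma size_row_or u v : size u = size v -> size (row_or u v) = size v.
Proof. by move=> e; rewrite size_map size2_zip ?e. Qed.

Lemma nth_row_or u v i : size u = size v ->
  nth false (row_or u v) i = nth false u i || nth false v i.
Proof.
move=> e; have [lt|ge] := ltnP i (size v).
  by rewrite (nth_map (false, false)) ?nth_zip // size2_zip ?e.
by rewrite !nth_default ?size_row_or ?e.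
Qed.

Lemma row_or_cat u1 v1 u2 v2 : size u1 = size u2 ->
  row_or (u1 ++ v1) (u2 ++ v2) = row_or u1 u2 ++ row_or v1 v2.
Proof. by move=> e; rewrite /row_or zip_cat // map_cat. Qed.

Lemma row_or_nseq q u : size u = q -> row_or (nseq q false) u = u.
Proof. by move<-; elim: u => //= b u IH; rewrite /row_or /= -/(row_or _ _) IH. Qed.

Lemma row_or_bits n (S T : {set 'I_n}) :
  row_or (bits S) (bits T) = bits (S :|: T)%SET.
Proof.
have e : size (bits S) = size (bits T) by rewrite !size_bits.
apply: (@eq_from_nth _ false) => [|i]; rewrite size_row_or // ?size_bits // => lt.
by rewrite nth_row_or // !(nth_bits _ (Ordinal lt)) inE.
Qed.

Lemma count_row_or u v : (count id (row_or u v) <= count id u + count id v)%N.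
Proof.
elim: u v => [|a u IH] [|b v] //=.
rewrite /row_or /= -/(row_or _ _); have := IH v; case: a; case: b => /=; lia.
Qed.

Lemma size_choices q z B r : all (fun s => size s == size z) B ->
  r \in choices q z B -> size r = (q + size z)%N.
Proof.
elim: q B r => [|q IH] [|s B] r /=; try by rewrite inE => _ /eqP ->.
  by move=> _ /mapP[u uin ->] /=; rewrite (IH [::]).
move=> /andP[/eqP es aB] /flatten_mapP[u uB].
have su := IH B u aB uB.
rewrite !inE => /orP[] /eqP -> /=; rewrite ?su // size_row_or ?su //.
by rewrite size_cat size_nseq es.
Qed.

Lemma count_choices q k m z B r : (count id z <= m)%N ->
  all (fun s => count id s <= k)%N B -> r \in choices q z B ->
  (count id r <= q * k.+1 + m)%N.
Proof.
move=> cz; elim: q B r => [|q IH] [|s B] r /=; try by rewrite inE => _ /eqP ->.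
  by move=> _ /mapP[u uin ->] /=; have := IH [::] u isT uin; lia.
move=> /andP[es aB] /flatten_mapP[u uB]; have cu := IH B u aB uB.
rewrite !inE => /orP[] /eqP -> /=; first by lia.
have := count_row_or (nseq q false ++ s) u.
by rewrite count_cat count_nseq /=; lia.
Qed.

(** The record entries alone are distinct, while the element parts may collide. The induction works
    on the records because uniting with a set padded by [false] leaves them unchanged. *)
Lemma uniq_choices q z B : all (fun s => size s == size z) B ->
  uniq (map (take q) (choices q z B)).
Proof.
elim: q B => [|q IH] B aB; first by case: B aB.
have uq (D : seq (seq bool)) : uniq D -> uniq [seq false :: r | r <- D].
  by rewrite map_inj_uniq // => u v [].
case: B aB => [|s B] /=.
  move=> _; rewrite -map_comp (eq_map (g := cons false \o take q)) //.
  by rewrite map_comp; apply/uq/IH.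
move=> /andP[/eqP es aB].
have -> : map (take q.+1) (flatten [seq [:: false :: r; true :: row_or (nseq q false ++ s) r]
    | r <- choices q z B])
   = flatten [seq [:: false :: u; true :: u] | u <- map (take q) (choices q z B)].
  rewrite map_flatten -!map_comp; congr flatten; apply/eq_in_map => r rB /=.
  have sr := size_choices aB rB; congr [:: _; _ :: _].
  rewrite -{1}[r](cat_take_drop q) row_or_cat ?size_nseq ?size_takel ?sr ?leq_addr //.
  rewrite row_or_nseq ?size_takel ?sr ?leq_addr //.
  by rewrite take_size_cat // size_takel ?sr ?leq_addr.
elim: (map _ _) (IH B aB) => //= u D IHD /andP[uD /IHD uf].
have nin b : b :: u \notin flatten [seq [:: false :: u; true :: u] | u <- D].
  apply/flatten_mapP => -[v vD]; rewrite !inE => /orP[] /eqP[_ E];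
  by rewrite E vD in uD.
by rewrite inE /= !nin uf.
Qed.

(** * Rows indexed by subfamilies *)

Section Rows.
Variable n : nat.
Implicit Types (X : {set {set 'I_n}}) (B : seq {set 'I_n}) (S : {set 'I_n}).

Definition union X B : {set 'I_n} := \bigcup_(S <- B | S \in X) S.

(** A description of the members of [choices] without recursion. The guard on [i] is there because
    the default [finset.set0] of [nth] may itself belong to [X]. *)
Definition row q X B : seq bool :=
  mkseq (fun i => (i < size B)%N && (nth finset.set0 B i \in X)) q ++ bits (union X B).

Lemma size_row q X B : size (row q X B) = (q + n)%N.
Proof. by rewrite size_cat size_mkseq size_bits. Qed.

Lemma row_cons q X S B : row q.+1 X (S :: B) =
  (S \in X) :: (if S \in X then row_or (nseq q false ++ bits S) (row q X B) else row q X B).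
Proof.
rewrite /row /mkseq [iota 0 q.+1]/= map_cons (iotaDl 1 0) -map_comp.
rewrite /union big_cons /=; congr (_ :: _); case: ifP => // SX.
by rewrite row_or_cat ?size_nseq ?size_mkseq // row_or_nseq ?size_mkseq // row_or_bits.
Qed.

Lemma row_nil q X : row q.+1 X [::] = false :: row q X [::].
Proof. by rewrite /row /mkseq [iota 0 q.+1]/= map_cons (iotaDl 1 0) -map_comp. Qed.

Lemma eq_row q X (Y : {set {set 'I_n}}) B :
  {in B, forall S, (S \in X) = (S \in Y)} -> row q X B = row q Y B.
Proof.
move=> E; rewrite /row; congr (_ ++ _).
  by apply/eq_mkseq => i; case: ltnP => //= lt; apply/E/mem_nth.
congr (@bits n _); rewrite /union big_seq_cond [RHS]big_seq_cond; apply: eq_bigl => S.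
by case SB: (S \in B) => //=; apply: E.
Qed.

Lemma choicesP q B r : (size B <= q)%N -> uniq B ->
  r \in choices q (nseq n false) (map (@bits n) B) <-> exists X, r = row q X B.
Proof.
elim: q B r => [|q IH] [|S B] r //=.
- move=> _ _; rewrite inE /row /union /= ; split=> [/eqP ->|[X ->]].
    by exists finset.set0; rewrite big_nil bits_set0.
  by rewrite big_nil bits_set0.
- move=> _ _; split=> [/mapP[u /(IH [::])[] // X -> ->]|[X ->]].
    by exists X; rewrite row_nil.
  by rewrite row_nil; apply/map_f/(IH [::]) => //; exists X.
rewrite ltnS => sB /andP[nS uB]; split.
  case/flatten_mapP => u /(IH B u sB uB)[X ->]; rewrite !inE.
  case/orP => /eqP ->.
    (* The [X] given by induction is arbitrary at [S], so [S] is removed here and added in the other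
       case. As [S] does not recur in [B], the rest of the row is unaffected. *)
    exists (X :\ S)%SET; rewrite row_cons !inE eqxx /=; congr (_ :: _); apply: eq_row => T TB.
    by rewrite !inE; case: eqP => // E; rewrite -E TB in nS.
  exists (S |: X)%SET; rewrite row_cons !inE eqxx /=.
  congr (_ :: row_or _ _); apply: eq_row => T TB.
  by rewrite !inE; case: eqP => // E; rewrite -E TB in nS.
case=> X ->; apply/flatten_mapP; exists (row q X B); first by apply/(IH B) => //; exists X.
by rewrite row_cons; case: (S \in X); rewrite !inE eqxx ?orbT.
Qed.

End Rows.

Lemma nth_onehot m i j : nth false (onehot m j) i = (i == j).
Proof.
rewrite /onehot nth_cat size_nseq nth_nseq; case: ltngtP => [lt|gt|->]; last by rewrite subnn.
  by [].
by case E: (i - j)%N => [|d]; [lia | rewrite /= nth_nseq if_same].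
Qed.

Lemma size_onehot m j : (j < m)%N -> size (onehot m j) = m.
Proof. by move=> lt; rewrite size_cat /= !size_nseq; lia. Qed.

Lemma nth_onehot_cat m i j r : (i < m)%N -> (j < m)%N ->
  nth false (onehot m j ++ r) i = (i == j).
Proof. by move=> li lj; rewrite nth_cat size_onehot // li nth_onehot. Qed.

Lemma uniq_flatten_disjoint (I R : eqType) (D : I -> seq R) (s : seq I) :
  uniq s -> {in s, forall j, uniq (D j)} ->
  {in s &, forall i j r, r \in D i -> r \in D j -> i = j} ->
  uniq (flatten [seq D j | j <- s]).
Proof.
elim: s => //= i s IH /andP[ni us] uD dD; rewrite cat_uniq uD ?mem_head //=.
apply/andP; split; last first.
  apply: IH => // [j js|j1 j2 js1 js2]; first by apply: uD; rewrite inE js orbT.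
  by apply: dD; rewrite inE ?js1 ?js2 orbT.
apply/hasPn => r /flatten_mapP[j js rj]; apply/negP => /= ri.
by move: ni; rewrite (dD i j _ _ _ ri rj) ?js // inE ?eqxx ?js ?orbT.
Qed.

Lemma count_bits n (S : {set 'I_n}) : count id (bits S) = #|S|.
Proof. by rewrite count_map cardE -size_filter /= enumT. Qed.

Lemma in_union n (X : {set {set 'I_n}}) B u :
  (u \in union X B) = [exists S, [&& S \in B, S \in X & u \in S]].
Proof.
rewrite /union; elim: B => [|S B IH].
  by rewrite big_nil inE; apply/esym/existsP => -[].
rewrite big_cons; apply/idP/existsP.
  case: ifP => SX; rewrite ?finset.in_setU IH.
    case/orP => [uS|/existsP[T /and3P[TB TX uT]]].
      by exists S; rewrite mem_head SX.
    by exists T; rewrite inE TB orbT TX.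
  by case/existsP => T /and3P[TB TX uT]; exists T; rewrite inE TB orbT TX.
case=> T /and3P[]; rewrite inE => /predU1P[->|TB] TX uT.
  by rewrite TX finset.in_setU uT.
have : u \in \bigcup_(S <- B | S \in X) S.
  by rewrite IH; apply/existsP; exists T; rewrite TB TX.
by case: ifP => // _; rewrite finset.in_setU => ->; rewrite orbT.
Qed.

(** * The family read off the rows, and its covers *)

Section Instance.
Variables (n q k : nat) (F : {set {set 'I_n}}) (L : seq {set 'I_n}).
Hypotheses (q_gt0 : (0 < q)%N) (LF : perm_eq L (enum F)).
Hypothesis Fk : forall S, S \in F -> (#|S| <= k)%N.

Let Bs := rev (chunks q L).
Let m := size Bs.
Let N := (m + (1 + (q + n)))%N.
Let z := nseq n false.

Let blk (j : nat) := nth [::] Bs j.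
Let full X (j : nat) := onehot m j ++ false :: row q X (blk j).
Let G X (j : 'I_m) := set_of_bits N (full X j).
Let Z := set_of_bits N (last_row q z m).
Let tag (j : 'I_m) : 'I_N := lshift _ j.
Let mark : 'I_N := rshift m (lshift _ ord0).
Let elt (u : 'I_n) : 'I_N := rshift m (rshift 1 (rshift q u)).
Let slot (j : 'I_m) S : 'I_N := insubd mark (m + (1 + index S (blk j)))%N.
Let rows := all_rows q z (map (map (@bits n)) Bs).

Lemma mem_L S : (S \in L) = (S \in F).
Proof. by rewrite (perm_mem LF) mem_enum. Qed.

Lemma uniq_L : uniq L.
Proof. by rewrite (perm_uniq LF) enum_uniq. Qed.

Lemma blk_in (j : nat) : (j < m)%N -> blk j \in chunks q L.
Proof. by move=> lt; rewrite -mem_rev mem_nth. Qed.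

Lemma size_blk (j : nat) : (j < m)%N -> (size (blk j) <= q)%N.
Proof. by move=> lt; apply: (size_chunk q_gt0 (blk_in lt)). Qed.

Lemma uniq_blk_disjoint (s : seq (seq {set 'I_n})) i j S : uniq (flatten s) ->
  S \in nth [::] s i -> S \in nth [::] s j -> i = j.
Proof.
elim: s i j => [|B s IH] [|i] [|j] //=; rewrite cat_uniq => /and3P[_ /hasPn nB us].
- move=> SB Sj; have [lt|ge] := ltnP j (size s); last by rewrite nth_default in Sj.
  have : S \in flatten s by apply/flattenP; exists (nth [::] s j) => //; apply: mem_nth.
  by move/nB; rewrite /= SB.
- move=> Sj SB; have [lt|ge] := ltnP i (size s); last by rewrite nth_default in Sj.
  have : S \in flatten s by apply/flattenP; exists (nth [::] s i) => //; apply: mem_nth.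
  by move/nB; rewrite /= SB.
- by move=> Si Sj; rewrite (IH i j).
Qed.

Lemma uniq_Bs : uniq (flatten Bs).
Proof.
have E : perm_eq Bs (chunks q L) by rewrite perm_rev.
by rewrite (perm_uniq (perm_flatten E)) flatten_chunks uniq_L.
Qed.

Lemma uniq_blk (j : nat) : uniq (blk j).
Proof.
rewrite /blk; elim: Bs uniq_Bs j => [|B s IH] /=; first by move=> _ [].
by rewrite cat_uniq => /and3P[uB _ us] [|j] //=; apply: IH.
Qed.

Lemma nth_after_onehot j b r i : (j < m)%N ->
  nth false (onehot m j ++ b :: r) (m + (1 + i)) = nth false r i.
Proof. by move=> lt; rewrite nth_cat size_onehot // ltnNge leq_addr /= addKn. Qed.

Lemma size_full X j : (j < m)%N -> size (full X j) = N.
Proof. by move=> lt; rewrite size_cat size_onehot //= size_row. Qed.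

Lemma size_last : size (last_row q z m) = N.
Proof. by rewrite size_cat /= size_cat !size_nseq. Qed.

Lemma nth_last_z i : nth false (last_row q z m) (m + (1 + i)) = (i < q)%N.
Proof.
rewrite /last_row nth_cat size_nseq ltnNge leq_addr /= addKn /= nth_cat size_nseq.
by rewrite add0n !nth_nseq if_same; case: (i < q)%N.
Qed.

(** One tag, at most [q] record entries, and at most [q] sets of at most [k] elements each. *)
Lemma card_G X (j : 'I_m) : (#|G X j| <= (q * k.+1).+1)%N.
Proof.
rewrite -count_bits bits_set_of_bits ?size_full //.
have le : (count id (row q X (blk j)) <= q * k.+1 + 0)%N.
  apply: (@count_choices _ _ _ z (map (@bits n) (blk j))).
  - by rewrite count_nseq.
  - apply/allP => _ /mapP[S SB ->]; rewrite count_bits Fk // -mem_L.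
    by rewrite -(flatten_chunks q L); apply/flattenP; exists (blk j) => //; apply: blk_in.
  - by apply/choicesP; [apply: size_blk | apply: uniq_blk | exists X].
rewrite count_cat /= add0n; suff : count id (onehot m j) = 1%N by lia.
by rewrite count_cat /= !count_nseq; lia.
Qed.

Lemma card_Z : (#|Z| <= (q * k.+1).+1)%N.
Proof.
rewrite -count_bits bits_set_of_bits ?size_last //.
rewrite /last_row count_cat /= count_cat !count_nseq /=; rewrite mulnS; lia.
Qed.

Let F' : {set {set 'I_N}} := selection_family G Z.

Lemma F'_small S : S \in F' -> (#|S| <= (q * k.+1).+1)%N.
Proof.
by case/setU1P => [->|/imsetP[x _ ->]]; [exact: card_Z | exact: card_G].
Qed.

Lemma card_covers :
  #|[set C in set_covers F' | #|C| == m.+1]%SET| = #|set_covers F|.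
Proof.
rewrite -(@card_selections _ _ m F (fun j S => S \in blk j) tag mark slot elt G Z).
- by apply: eq_card => D; rewrite !inE.
- move=> S; rewrite -mem_L -(flatten_chunks q L) => /flattenP[B].
  rewrite -mem_rev -/Bs => /(nthP [::])[j lt <-] Sj.
  by exists (Ordinal lt).
- move=> j S Sj; rewrite -mem_L -(flatten_chunks q L); apply/flattenP.
  by exists (blk j) => //; apply: blk_in.
- move=> j i S Sj Si; apply: val_inj; exact: uniq_blk_disjoint uniq_Bs Sj Si.
- move=> v; case: (split_ordP v) => [j ->|w ->]; first by constructor 1; exists j.
  case: (split_ordP w) => [i ->|w' ->].
    by constructor 2; rewrite inE /= /last_row nth_cat size_nseq ltnNge leq_addr /= addKn (ord1 i).
  case: (split_ordP w') => [i ->|u ->]; last by constructor 3; exists u.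
  by constructor 2; rewrite inE /= nth_last_z.
- move=> j; rewrite inE /= /last_row nth_cat size_nseq ltn_ord nth_nseq.
  by rewrite ltn_ord.
- by rewrite inE /= /last_row nth_cat size_nseq addn0 ltnn subnn.
- by move=> u; rewrite inE /= nth_last_z ltnNge leq_addr.
- by move=> X j i; rewrite inE /= nth_onehot_cat.
- by move=> X j; rewrite inE /= nth_cat size_onehot // addn0 ltnn subnn.
- move=> X j S Sj; have lt : (index S (blk j) < size (blk j))%N by rewrite index_mem.
  have ltq := leq_trans lt (size_blk (ltn_ord j)).
  rewrite inE /= val_insubd ifT; last by rewrite /N; lia.
  by rewrite nth_after_onehot // nth_cat size_mkseq ltq nth_mkseq // lt nth_index.
- move=> X j u; rewrite inE /= nth_after_onehot // nth_cat size_mkseq.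
  by rewrite ltnNge leq_addr /= addKn nth_bits in_union.
- by move=> X Y j E; rewrite /G /full; congr (set_of_bits N (_ ++ _ :: _)); apply: eq_row.
Qed.

Lemma size_rows r : r \in rows -> size r = N.
Proof.
rewrite mem_cat inE size_map => /orP[|/eqP ->]; last exact: size_last.
case/flatten_mapP => j; rewrite mem_iota add0n => /andP[_ lt] /mapP[u uB ->].
move: uB; rewrite (nth_map [::]) // => /choicesP[||X ->].
- exact: size_blk.
- exact: uniq_blk.
- by rewrite -(size_full X lt) /full !size_cat /=.
Qed.

Lemma mem_rows r : r \in rows <->
  (exists X, exists2 j, (j < m)%N & r = full X j) \/ r = last_row q z m.
Proof.
rewrite mem_cat inE size_map -/m; split.
  case/orP => [|/eqP ->]; last by right.
  case/flatten_mapP => j; rewrite mem_iota add0n => /andP[_ lt] /mapP[u uB ->].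
  move: uB; rewrite (nth_map [::]) // => /choicesP[||X ->].
  - exact: size_blk.
  - exact: uniq_blk.
  - by left; exists X, j.
case=> [[X [j lt ->]]|->]; last by rewrite eqxx orbT.
apply/orP; left; apply/flatten_mapP; exists j; first by rewrite mem_iota.
apply/map_f; rewrite (nth_map [::]) //; apply/choicesP.
- exact: size_blk.
- exact: uniq_blk.
- by exists X.
Qed.

(** The encoding must list each set exactly once. The mark at position [m] singles out the last row,
    tags separate the blocks, and record entries separate the rows of a block. *)
Lemma uniq_rows : uniq rows.
Proof.
rewrite cat_uniq size_map -/m; apply/and3P; split=> //; last first.
  rewrite /= orbF; apply/flatten_mapP => -[j]; rewrite mem_iota add0n => /andP[_ lt].
  case/mapP => u _ E; have := congr1 (nth false ^~ m) E.
  rewrite /last_row !nth_cat size_nseq size_onehot // ltnn subnn //=.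
apply: uniq_flatten_disjoint; first exact: iota_uniq.
  move=> j; rewrite mem_iota add0n => /andP[_ lt].
  rewrite map_inj_uniq; last by move=> u v /eqP; rewrite eqseq_cat // eqxx => /eqP[].
  apply: (@map_uniq _ _ (take q)); apply: uniq_choices.
  rewrite (nth_map [::]) //; apply/allP => _ /mapP[S _ ->].
  by rewrite size_bits size_nseq.
move=> i j; rewrite !mem_iota !add0n => /andP[_ lti] /andP[_ ltj] r /mapP[u _ ->].
case/mapP => v _ E; have := congr1 (nth false ^~ i) E.
by rewrite /= !nth_onehot_cat // eqxx => /esym/eqP.
Qed.

Lemma reduction_instance : exists I : sc_instance (q * k.+1).+1,
  [/\ encodes (p := parity_set_cover (q * k.+1).+1) I
        (enc (reduction q (nseq n tt, map (@bits n) L))),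
      answer (p := parity_set_cover (q * k.+1).+1) I = odd #|set_covers F| &
      sc_n I = N /\ sc_t I = m.+1].
Proof.
exists (@ScInstance _ N m.+1 F' F'_small); split => //=; last by rewrite card_covers.
have sC : size (chunks q L) = m by rewrite /m size_rev.
exists (enc (nseq N tt, rows)); last first.
  rewrite /reduction /= chunks_map !size_map size_nseq sC -map_rev -/Bs -/z.
  by rewrite size_last.
exists (map (set_of_bits N) rows); last first.
  rewrite {1}/enc /enc_prod /=; congr (Node _ (list_tree _)).
    by rewrite /enc /enc_seq map_nseq.
  rewrite -map_comp; apply/eq_in_map => r /size_rows sr /=.
  by rewrite -enc_bits bits_set_of_bits.
apply: uniq_perm; [|exact: enum_uniq|].
  rewrite map_inj_in_uniq ?uniq_rows // => r1 r2 /size_rows s1 /size_rows s2 E.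
  by rewrite -(bits_set_of_bits s1) E bits_set_of_bits.
move=> S; rewrite mem_enum; apply/mapP/setU1P.
  case=> r /mem_rows[[X [j lt ->]]|->] ->; last by left.
  by right; apply/imsetP; exists (X, Ordinal lt).
case=> [->|/imsetP[[X j] _ ->]].
  by exists (last_row q z m) => //; apply/mem_rows; right.
by exists (full X j) => //; apply/mem_rows; left; exists X, (j : nat).
Qed.

Lemma block_number : (q * m <= #|F| + q)%N.
Proof.
rewrite /m size_rev (cardE F) -(perm_size LF).
exact: size_chunks.
Qed.

End Instance.

(** * Exponents *)

Import Order.TTheory GRing.Theory Num.Theory.
Local Open Scope ring_scope.

Lemma error_prob_seq (R : realType) p0 p x y t0 b T :
  exec p0 (init x) [::] (init y) t0 -> halts_within p y T ->
  error_prob R (Seq p0 p) x b (t0 + T) <= error_prob R p y b T.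
Proof.
move=> exec0 H; rewrite /error_prob ler_pdivrMr ?exprn_gt0 ?ltr0n //.
rewrite exprD [2 ^+ t0 * _]mulrC mulrA divfK ?expf_neq0 ?pnatr_eq0 //.
rewrite -natrX -natrM ler_nat.
apply: card_take_tuple => w /asboolP[v [t [pv rv]]].
have [t' rv' _] := run_seq_inv exec0 rv.
have sT : size (take T w) == T by rewrite size_take_min size_tuple; apply/eqP; lia.
exists (Tuple sT) => //=; apply/asboolP.
(* A priori the erring run could read beyond the first [T] coins. By determinism it is the run that
   halts on those coins, so it does not. *)
have [v1 [b1 [t1 [pv1 rv1 _]]]] := H (Tuple sT).
have pv1' : prefix v1 w by apply: prefix_trans pv1 (prefix_take _ _).
have [E1 E2 E3] := run_det rv1 rv' pv1' pv; subst.
by exists v, t'.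
Qed.

(** The factor [A] lets the reduction enlarge the parameter by an additive constant; it ends up in
    the coefficient of the polynomial. *)
Lemma solvable_in_many_one (R : realType) (P Q : problem) (e e' : R) (A : nat) p0 a b :
  (forall (I : instance P) x, encodes I x -> exists (J : instance Q) y,
    [/\ encodes J y, answer J = answer I,
        exists2 t, exec p0 (init x) [::] (init y) t & (t <= (tsize x).+1 ^ a)%N,
        (tsize y <= (tsize x).+1 ^ b)%N &
        2 `^ (e' * (param J)%:R) <= 2 `^ (e * (param I)%:R) * A%:R :> R]) ->
  0 < e -> solvable_in Q e' -> solvable_in P e.
Proof.
move=> H e0 [p [C [d Hp]]].
(* The two summands pay for [p] on the reduced instance and for the reduction. The powers of 2 come
   from [S.+1 ^ i <= 2 ^ i * S ^ i]. *)
exists (Seq p0 p), (A * C * 2 ^ (b * d) + 2 ^ a)%N, (b * d + a)%N => I x Ix.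
have [J [y [Jy JI [t0 E0 t0x] yx pJ]]] := H I x Ix.
have [T [TJ HT errT]] := Hp J y Jy.
exists (t0 + T)%N; split.
- set S := tsize x in t0x yx *; have S0 : (0 < S)%N := tsize_gt0 x.
  have powS i : (S.+1 ^ i <= 2 ^ i * S ^ i)%N.
    by rewrite -expnMn; case: i => // i; rewrite leq_exp2r //; lia.
  have SX i j : (S ^ i <= S ^ (i + j))%N by rewrite leq_pexp2l // leq_addr.
  set W := 2 `^ (e * (param I)%:R).
  have W1 : 1 <= W.
    by rewrite -(powRr0 2) ler_powR ?ler1n // mulr_ge0 // ltW.
  have h0 : (t0 <= 2 ^ a * S ^ (b * d + a))%N.
    apply: leq_trans t0x _; apply: leq_trans (powS a) _.
    by rewrite leq_mul2l addnC SX orbT.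
  have h1 : (tsize y ^ d <= 2 ^ (b * d) * S ^ (b * d + a))%N.
    apply: (@leq_trans ((S.+1 ^ b) ^ d)); first by case: (d) => // i; rewrite leq_exp2r.
    rewrite -expnM; apply: leq_trans (powS _) _.
    by rewrite leq_mul2l SX orbT.
  have W0 : 0 <= W by apply: le_trans W1.
  rewrite natrD; apply: (@le_trans _ _ (W * (2 ^ a * S ^ (b * d + a))%:R
      + W * A%:R * (C%:R * (2 ^ (b * d) * S ^ (b * d + a))%:R))).
    apply: lerD.
      apply: (@le_trans _ _ (2 ^ a * S ^ (b * d + a))%:R); first by rewrite ler_nat.
      by rewrite ler_peMl // ler0n.
    apply: (le_trans TJ); apply: ler_pM => //; rewrite ?powR_ge0 //.
    by rewrite -natrX ler_wpM2l // ler_nat.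
  rewrite -!mulrA -mulrDr ler_wpM2l // -!natrX -!natrM -natrD ler_nat.
  by rewrite mulnDl addnC !mulnA.
- exact: (halts_within_seq E0 HT).
- rewrite -JI; apply: le_trans errT; exact: (error_prob_seq _ _ E0 HT).
Qed.

Lemma pt_esize_bound A B {EA : Enc A} {EB : Enc B} (f : A -> B) : polytime f ->
  exists b, forall a, (esize (f a) <= (esize a).+1 ^ b)%N.
Proof. by case. Qed.

Lemma solvable_in_sparse (R : realType) (c : nat -> R) (k q : nat) (e e' : R) :
  (0 < q)%N -> 0 < e -> 0 < e' -> e' * (1 + 2 * `|c k| / q%:R) <= e ->
  solvable_in (parity_set_cover (q * k.+1).+1) e' ->
  solvable_in (sparse_parity_set_cover k c) e.
Proof.
move=> q0 e0 e'0 ee'; have [p0 [a Hp0]] := pt_program (pt_reduction q).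
have [b Hb] := pt_esize_bound (pt_reduction q).
(* The new parameter is [n + 2 m + q + 2], and [m] is at most [|c k| n / q + 1]; the part
   independent of [n] is therefore [q + 4]. *)
have [A HA] : exists A : nat, 2 `^ (e' * (q + 4)%:R) <= A%:R :> R.
  exists (Num.bound (2 `^ (e' * (q + 4)%:R) : R)).
  by apply/ltW/archi_boundP; apply: powR_ge0.
apply: (@solvable_in_many_one R _ _ e e' A p0 a b) => // -[n F Fk Fs] x /= [L LF ->].
pose x0 := (nseq n tt, map (@bits n) L).
have -> : Node (list_tree (nseq n Leaf)) (list_tree (map (@set_tree n) L)) = enc x0.
  rewrite /x0 {1}/enc /enc_prod /=; congr (Node _ (list_tree _)).
    by rewrite /enc /enc_seq map_nseq.
  by rewrite -map_comp; apply: eq_map => S /=; rewrite enc_bits.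
have [J [Jx JF [nJ tJ]]] := reduction_instance q0 LF Fk.
exists J, (enc (reduction q x0)); split; [exact: Jx|exact: JF|exact: Hp0|exact: Hb|].
rewrite /= nJ tJ.
have := block_number q0 LF; set m := size _ => qm.
have q0' : 0 < q%:R :> R by rewrite ltr0n.
(* [c k] may be negative; its absolute value keeps the bound valid and the factor on [e'] at least
   1. *)
have mle : m%:R <= `|c k| / q%:R * n%:R + 1 :> R.
  rewrite -(ler_pM2l q0') mulrDr mulr1 mulrA mulrCA mulfV ?gt_eqF // mulr1.
  apply: (@le_trans _ _ (#|F|%:R + q%:R)); first by rewrite -natrM -natrD ler_nat.
  rewrite lerD2r; apply: le_trans Fs _.
  by rewrite ler_wpM2r // ler_norm.
have le : e' * (m + (1 + (q + n)) + m.+1)%:R <= e * n%:R + e' * (q + 4)%:R.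
  apply: (@le_trans _ _ (e' * (1 + 2 * `|c k| / q%:R) * n%:R + e' * (q + 4)%:R)).
    rewrite -mulrA -mulrDr ler_wpM2l ?(ltW e'0) //.
    have -> : (m + (1 + (q + n)) + m.+1 = n + (2 * m + (q + 2)))%N by lia.
    rewrite !natrD ?natrM mulrDl mul1r -[2 * _ / _]mulrA -[2 * _ * _]mulrA.
    set u := _ / _ * _ in mle *; lra.
  by rewrite lerD2r ler_wpM2r.
apply: (@le_trans _ _ (2 `^ (e * n%:R + e' * (q + 4)%:R))).
  by apply: ler_powR => //; rewrite ler1n.
rewrite powRD; last by apply/implyP => _; rewrite pnatr_eq0.
by rewrite ler_wpM2l // powR_ge0.
Qed.

(** * Infima and limits of exponents *)

Lemma sigma_lbound (R : realType) (P : problem) (e : R) :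
  0 < e -> solvable_in P e -> (sigma R P <= e%:E)%E.
Proof. by move=> e0 Pe; apply: ereal_inf_lbound; exists e. Qed.

Lemma sigma_ge0 (R : realType) (P : problem) : (0 <= sigma R P)%E.
Proof.
by apply: le_ereal_inf_tmp => _ [e [e0 _ ->]]; rewrite lee_fin ltW.
Qed.

Lemma sigma_gt (R : realType) (P : problem) (e : R) :
  (sigma R P < e%:E)%E -> exists e', [/\ 0 < e', solvable_in P e' & e' < e].
Proof. by case/ereal_inf_lt => _ [e' [e'0 Pe' ->]]; rewrite lte_fin => lt; exists e'. Qed.

(** An instance with sets of size at most [k] is also one for [k'], with the same encodings, so an
    algorithm for [k'] serves [k]. The limit on the right is thus a supremum. *)
Lemma sigma_parity_set_cover_nd (R : realType) :
  nondecreasing_seq (fun k => sigma R (parity_set_cover k)).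
Proof.
move=> k k' kk'; apply: ereal_inf_le_tmp => _ [e [e0 [p [C [d H]]] ->]].
exists e; split=> //; exists p, C, d => -[n t F Fk] x Ix.
have Fk' S : S \in F -> (#|S| <= k')%N by move=> /Fk le; apply: leq_trans le kk'.
exact: (H (@ScInstance k' n t F Fk') x Ix).
Qed.

(* For a non-monotone c the exponents on the left need not converge; the limit
   superior is their limit whenever they do. *)
Theorem theorem19 (R : realType) (c : nat -> R) :
  cvgn (fun k' : nat => sigma R (parity_set_cover k')) /\
  (limn_esup (fun k : nat => sigma R (sparse_parity_set_cover k c))
   <= limn (fun k' : nat => sigma R (parity_set_cover k')))%E.
Proof.
have nd := @sigma_parity_set_cover_nd R.
split; first exact: ereal_nondecreasing_is_cvgn.
have /cvg_lim -> // := ereal_nondecreasing_cvgn nd.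
set l := ereal_sup _.
have ul k : (sigma R (parity_set_cover k) <= l)%E by apply: ereal_sup_ubound; exists k.
(* The supremum [l] dominates the exponent at every set size, whatever size the reduction for this
   [k] produces, so each [k] can be treated separately. *)
suff H k : (sigma R (sparse_parity_set_cover k c) <= l)%E.
  rewrite limn_esup_lim; apply: lime_le; first exact: is_cvg_esups.
  by apply: nearW => n; apply: ge_ereal_sup => _ [k _ <-].
have := le_trans (sigma_ge0 R (parity_set_cover 0)) (ul 0%N).
case/gee0P => [->|[r r0 lr]]; first by rewrite leey.
apply/lee_addgt0Pr => d d0; rewrite lr -EFinD.
(* Of the slack [d], one half lets [e'] exceed [r]. The other half must cover
   [(r + d / 2) * 2 |c k| / q], which dictates this [q]; the successor makes it positive. *)
pose q := (Num.bound ((r + d / 2) * (4 * `|c k|) / d)).+1.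
have q0 : 0 < q%:R :> R by rewrite ltr0n.
have qb : (r + d / 2) * (4 * `|c k|) / d <= q%:R.
  apply: (@le_trans _ _ (Num.bound ((r + d / 2) * (4 * `|c k|) / d))%:R).
    by apply/ltW/archi_boundP; rewrite !mulr_ge0 ?invr_ge0 ?addr_ge0 // ?ltW // divr_gt0.
  by rewrite ler_nat.
have [e' [e'0 Pe' e'r]] : exists e', [/\ 0 < e',
    solvable_in (parity_set_cover (q * k.+1).+1) e' & e' < r + d / 2].
  apply: sigma_gt; apply: le_lt_trans (ul _) _; rewrite lr lte_fin.
  by rewrite ltrDl divr_gt0.
have rd0 : 0 < r + d by rewrite ltr_wpDl.
apply: sigma_lbound => //.
apply: (solvable_in_sparse _ rd0 e'0 _ Pe') => //.
apply: (@le_trans _ _ ((r + d / 2) * (1 + 2 * `|c k| / q%:R))).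
  by rewrite ler_wpM2r ?ltW // addr_ge0 // !mulr_ge0 // invr_ge0 ltW.
move: qb; rewrite ler_pdivrMr // => qb.
rewrite mulrDr mulr1 [r + d](_ : _ = r + d / 2 + d / 2); last by lra.
rewrite lerD2l mulrA ler_pdivrMr //; lra.
Qed.
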